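(* Let $p>1$, $q>p-1$, $N=2$, $\beta_q=\frac{p}{q+1-p}$ and $\lambda_{q,p}=\beta_q(q\beta_q-2)$. Let $S$ be any angular sector of $S^1$ (an open arc of length in $(0,2\pi)$). Then there exists a positive solution $\omega$ in $S$ of $$-\frac{d}{d\sigma}\Big[\big(\beta_q^2\omega^2+\omega_\sigma^2\big)^{p/2-1}\omega_\sigma\Big]-|\omega|^{q-1}\omega=\lambda_{q,p}\big(\beta_q^2\omega^2+\omega_\sigma^2\big)^{p/2-1}\omega$$ vanishing at the two end points of $S$ if and only if $\beta_q<\beta_S$, where $\beta_S>0$ is the spherical $p$-harmonic exponent of $S$ (defined in the context). Furthermore this solution is unique. In particular, existence holds for any sector $S$ if $p<2$ and $q\ge 2(p-1)/(2-p)$.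
   Context: $\omega_\sigma=d\omega/d\sigma$, where $\sigma$ is the angular variable on $S^1$. Definition of $\beta_S$: for an open arc $S\subset S^1$ of length in $(0,2\pi)$ it is known that there is a unique $\beta=\beta_S>0$ for which there exists a function $\phi>0$ in $S$ (unique up to multiplication by a positive constant), vanishing at the two end points of $S$, with $$-\frac{d}{d\sigma}\Big[\big(\beta^2\phi^2+\phi_\sigma^2\big)^{p/2-1}\phi_\sigma\Big]=\beta\big(\beta(p-1)+p-2\big)\big(\beta^2\phi^2+\phi_\sigma^2\big)^{p/2-1}\phi\quad\text{in }S ,$$ where $\phi_\sigma=d\phi/d\sigma$. Equivalently, $r^{-\beta_S}\phi(\sigma)$ is a positive $p$-harmonic function in the plane sector $\{(r,\sigma):r>0,\sigma\in S\}$ vanishing on its boundary minus the vertex. *)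

(* Defs.v *)
From Stdlib Require Import Reals.
From Coquelicot Require Import Coquelicot.
Open Scope R_scope.

(** An open arc [S] of the circle is given by the interval [(a, b)] of values of
    the angular variable on it, with [0 < b - a < 2 * PI]; [sigma |-> (cos sigma,
    sin sigma)] is then injective on [[a, b]], and a function on [S] is a
    function of [sigma] whose values outside [(a, b)] are irrelevant. *)
Definition is_arc (a b : R) : Prop := 0 < b - a < 2 * PI.

(** [Rpower 0 y = 1] by convention in the library; below, powers are only
    evaluated where [w] is positive, hence at positive bases. *)
Definition weight (p beta : R) (w : R -> R) (sigma : R) : R :=
  Rpower (beta ^ 2 * w sigma ^ 2 + Derive w sigma ^ 2) (p / 2 - 1).

Definition flux (p beta : R) (w : R -> R) (sigma : R) : R :=
  weight p beta w sigma * Derive w sigma.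

Definition positive_vanishing (a b : R) (w : R -> R) : Prop :=
  (forall sigma, a < sigma < b -> 0 < w sigma) /\
  filterlim w (at_right a) (locally 0) /\
  filterlim w (at_left b) (locally 0).

(** [Derive] is total, so differentiability of [w] and of the flux is required
    explicitly. *)
Definition flux_regular (p beta a b : R) (w : R -> R) : Prop :=
  forall sigma, a < sigma < b ->
    ex_derive w sigma /\ ex_derive (flux p beta w) sigma.

Definition spherical_p_harmonic (p beta a b : R) (phi : R -> R) : Prop :=
  positive_vanishing a b phi /\
  flux_regular p beta a b phi /\
  forall sigma, a < sigma < b ->
    - Derive (flux p beta phi) sigma
    = beta * (beta * (p - 1) + p - 2) * weight p beta phi sigma * phi sigma.

(** [beta] is the exponent [beta_S] of the arc [S = (a, b)]. *)
Definition is_spherical_exponent (p a b beta : R) : Prop :=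
  0 < beta /\ exists phi : R -> R, spherical_p_harmonic p beta a b phi.

Definition beta_q (p q : R) : R := p / (q + 1 - p).

(** The dimension of the ambient space is [2]. *)
Definition lambda_qp (p q : R) : R := beta_q p q * (q * beta_q p q - 2).

Definition positive_solution (p q a b : R) (w : R -> R) : Prop :=
  positive_vanishing a b w /\
  flux_regular p (beta_q p q) a b w /\
  forall sigma, a < sigma < b ->
    - Derive (flux p (beta_q p q) w) sigma
      - Rpower (Rabs (w sigma)) (q - 1) * w sigma
    = lambda_qp p q * weight p (beta_q p q) w sigma * w sigma.

(* Main.v *)
Require Import Defs.
From Stdlib Require Import Reals Lra Classical ClassicalEpsilon.
From Coquelicot Require Import Coquelicot.
Open Scope R_scope.

(** Write [w' = be w tan al], [s = cos^2 al], [V = be w^(q+1) / (be^2 w^2 + w'^2)^(p/2)],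
    [K = (p-1)(1+be)], [X = K + V] and [m = p-1 - (p-2)s], where [be = beta_q].  The equation
    for [w] is equivalent to the autonomous system [al' = 1 - X/m], [V' = p tan(al) V X/m], and
    the spherical [p]-harmonic equation is its case [V = 0], that is [al' = 1 - K_S/m].  In a
    trajectory [1/s] solves a linear equation as a function of [X], which gives an explicit
    first integral, whose value [h] is positive when [w] vanishes at an end of the arc; then
    [X > m], [al] decreases from [PI/2] to [-PI/2], and [X] is a function of [s] and [h],
    increasing in [h].  The length of the arc, [int m/(X-m) d al], is therefore decreasing in
    [h], which gives uniqueness; since [X > K], it is smaller than the length of the arc of
    spherical exponent [be], which gives necessity.  It is continuous in [h], tends to [0] as
    [h] grows, and exceeds any length available to a larger exponent when [h] is small (it is
    unbounded when [K <= 1], the case of the last claim), which gives existence. *)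

(** The linear equation is [d(1/s)/dX = 2 ((p-1-X)/s - (p-2)) / (p V X)]. Partial fractions of
    [(X-(p-1)) / (X V)], with [V = X - K], give the integrating factor
    [X^(2/(p(1+be))) V^(2 be/(p(1+be)))], whence [lead_exp] and [gamma_exp].

    Two obstacles shape the argument. The hypotheses give a derivative to [w] and to its flux, but
    none to [w']; the angle is shown to be differentiable by inverting the strictly increasing
    function that expresses the flux through the slope. Moreover, comparing lengths by a change of
    variables would require monotone angles and their limits. Instead the time [Theta h al] that a
    trajectory of level [h] takes to descend from [al] to [-PI/2] serves as a clock:
    [Theta h (al x) + x] is constant along a trajectory of level [h], and along any other one its
    monotonicity follows from comparing two speeds at the same angle. Its behaviour at the ends of
    the arc is controlled as soon as the slope is unbounded above near [a] and below near [b]. *)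

Lemma Rpower_pos (x y : R) : 0 < Rpower x y.
Proof. apply exp_pos. Qed.

Lemma is_derive_Rpower (f : R -> R) (x df r : R) :
  0 < f x -> is_derive f x df ->
  is_derive (fun y => Rpower (f y) r) x (r * Rpower (f x) r * df / f x).
Proof.
  intros hf hd. unfold Rpower.
  evar_last.
  { apply (is_derive_comp exp (fun y => r * ln (f y))).
    { apply is_derive_exp. }
    { apply (is_derive_scal (fun y => ln (f y))).
      apply (is_derive_comp ln f); [apply is_derive_ln, hf | exact hd]. } }
  unfold scal; simpl; unfold mult; simpl. field. lra.
Qed.

Lemma is_derive_continuous (f : R -> R) (x l : R) : is_derive f x l -> continuous f x.
Proof. intros h. apply (ex_derive_continuous f). now exists l. Qed.

Lemma continuous_Rpower (f : R -> R) (x r : R) :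
  0 < f x -> continuous f x -> continuous (fun y => Rpower (f y) r) x.
Proof.
  intros hf hc.
  apply (continuous_comp f (fun z => Rpower z r)); [exact hc |].
  eapply is_derive_continuous, (is_derive_Rpower (fun z => z)); [exact hf | apply is_derive_id].
Qed.

Lemma derive_pos_lt (f df : R -> R) (x y : R) :
  x < y ->
  (forall z, x < z < y -> is_derive f z (df z)) ->
  (forall z, x < z < y -> 0 < df z) ->
  (forall z, x <= z <= y -> continuous f z) ->
  f x < f y.
Proof.
  intros hxy hd hpos hc.
  (* [MVT_gen] may return an end point, where nothing is known about [df]; the value [1] keeps the
     conclusion strict there. *)
  set (d := fun z => if excluded_middle_informative (x < z < y) then df z else 1).
  destruct (MVT_gen f x y d) as [c [_ hcd]].
  - rewrite Rmin_left, Rmax_right by lra. intros z hz. unfold d.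
    destruct (excluded_middle_informative (x < z < y)); [now apply hd | tauto].
  - rewrite Rmin_left, Rmax_right by lra. intros z hz.
    apply continuity_pt_filterlim, hc, hz.
  - assert (hdc : 0 < d c).
    { unfold d. destruct (excluded_middle_informative (x < c < y)) as [h|h]; [now apply hpos | lra]. }
    nra.
Qed.

Lemma derive_nonneg_le (f df : R -> R) (x y : R) :
  x <= y ->
  (forall z, x <= z <= y -> is_derive f z (df z)) ->
  (forall z, x <= z <= y -> 0 <= df z) ->
  f x <= f y.
Proof.
  intros hxy hd hpos.
  destruct (MVT_gen f x y df) as [c [hc hcd]].
  - rewrite Rmin_left, Rmax_right by lra. intros z hz. apply hd. lra.
  - rewrite Rmin_left, Rmax_right by lra. intros z hz.
    apply continuity_pt_filterlim. eapply is_derive_continuous, hd, hz.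
  - rewrite Rmin_left, Rmax_right in hc by lra. specialize (hpos c hc). nra.
Qed.

Lemma locally_intro (P : R -> Prop) (x d : R) :
  0 < d -> (forall v, Rabs (v - x) < d -> P v) -> locally x P.
Proof. intros hd h. exists (mkposreal d hd). exact h. Qed.

Lemma locally_elim (P : R -> Prop) (x : R) :
  locally x P -> exists d, 0 < d /\ forall v, Rabs (v - x) < d -> P v.
Proof. intros [d hd]. exists d. split; [apply cond_pos | exact hd]. Qed.

Lemma continuous_eps (f : R -> R) (x : R) :
  (forall eps, 0 < eps -> locally x (fun y => f x - eps < f y < f x + eps)) ->
  continuous f x.
Proof.
  intros h. apply filterlim_locally. intros eps.
  apply (filter_imp (fun y => f x - eps < f y < f x + eps)); [| apply h, cond_pos].
  intros y hy. unfold ball; simpl; unfold AbsRing_ball, abs, minus, plus, opp; simpl.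
  apply Rabs_lt_between. lra.
Qed.

Lemma continuous_locally (f : R -> R) (x eps : R) :
  0 < eps -> continuous f x -> locally x (fun y => f x - eps < f y < f x + eps).
Proof.
  intros he hc.
  apply (filter_imp (fun y => ball (f x) (mkposreal eps he) (f y))).
  - intros y hy. unfold ball in hy; simpl in hy;
      unfold AbsRing_ball, abs, minus, plus, opp in hy; simpl in hy.
    apply Rabs_lt_between in hy. lra.
  - exact (proj1 (filterlim_locally _ _) hc (mkposreal eps he)).
Qed.

Lemma locally_lt_gt (x lo hi : R) : lo < x < hi -> locally x (fun y => lo < y < hi).
Proof.
  intros h. assert (hd : 0 < Rmin (x - lo) (hi - x)) by (apply Rmin_pos; lra).
  apply (locally_intro _ _ _ hd). intros y hy.
  apply Rabs_lt_between in hy.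
  pose proof (Rmin_l (x - lo) (hi - x)). pose proof (Rmin_r (x - lo) (hi - x)). lra.
Qed.

(** * Regularity of [y] deduced from that of [g] composed with [y] *)

Lemma inverse_continuous (D : R -> Prop) (g y : R -> R) (x : R) :
  (forall u v, D u -> D v -> u < v -> g u < g v) ->
  locally (y x) D -> locally x (fun z => D (y z)) ->
  continuous (fun z => g (y z)) x -> continuous y x.
Proof.
  intros hg hD hDy hc. apply continuous_eps. intros eps heps.
  destruct (locally_elim _ _ hD) as [d [hd0 hd]].
  set (e := Rmin eps d / 2).
  assert (he : 0 < e < eps /\ e < d).
  { unfold e. pose proof (Rmin_l eps d). pose proof (Rmin_r eps d).
    assert (0 < Rmin eps d) by (now apply Rmin_pos). lra. }
  assert (hball : forall z, y x - e <= z <= y x + e -> D z).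
  { intros z hz. apply hd, Rabs_lt_between. lra. }
  assert (h1 : g (y x - e) < g (y x)) by (apply hg; [apply hball | apply hball |]; lra).
  assert (h2 : g (y x) < g (y x + e)) by (apply hg; [apply hball | apply hball |]; lra).
  set (r := Rmin (g (y x) - g (y x - e)) (g (y x + e) - g (y x))).
  assert (hr : 0 < r) by (apply Rmin_pos; lra).
  generalize (filter_and _ _ hDy (continuous_locally (fun z => g (y z)) x r hr hc)).
  apply filter_imp. intros z [hz1 hz2].
  assert (r <= g (y x) - g (y x - e)) by apply Rmin_l.
  assert (r <= g (y x + e) - g (y x)) by apply Rmin_r.
  split; apply Rnot_le_lt; intros hn.
  - assert (g (y z) < g (y x - e)); [| lra].
    apply hg; [exact hz1 | apply hball; lra | lra].
  - assert (g (y x + e) < g (y z)); [| lra].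
    apply hg; [apply hball; lra | exact hz1 | lra].
Qed.

(** Carathéodory's form of the derivative. If [k] is the difference quotient of [g] at [y x],
    completed by [l], then [g (y z) - g (y x) = k (y z) (y z - y x)] even when [y z = y x]. The
    difference quotient of [y] is therefore [Q z / k (y z)], a quotient of functions continuous at
    [x] with nonzero denominator there. *)
Lemma inverse_derive (g y : R -> R) (x l d : R) :
  continuous y x -> is_derive g (y x) l -> l <> 0 ->
  is_derive (fun z => g (y z)) x d -> is_derive y x (d / l).
Proof.
  intros hy hg hl hgy.
  set (k := fun v => if excluded_middle_informative (v = y x) then l
                     else (g v - g (y x)) / (v - y x)).
  assert (hk0 : k (y x) = l).
  { unfold k. destruct (excluded_middle_informative (y x = y x)); tauto. }
  assert (hk : continuous k (y x)).
  { apply continuous_eps. intros eps heps. rewrite hk0.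
    apply is_derive_Reals in hg.
    destruct (hg eps heps) as [dl hdl]. apply (locally_intro _ _ dl (cond_pos dl)). intros v hv.
    unfold k. destruct (excluded_middle_informative (v = y x)) as [e|e]; [lra |].
    specialize (hdl (v - y x)).
    replace (y x + (v - y x)) with v in hdl by ring.
    assert (hb : Rabs ((g v - g (y x)) / (v - y x) - l) < eps) by (apply hdl; [lra | exact hv]).
    apply Rabs_lt_between in hb. lra. }
  assert (hkc : continuous (fun z => k (y z)) x).
  { apply (continuous_comp y k); [exact hy | exact hk]. }
  set (Q := fun z => if excluded_middle_informative (z = x) then d
                     else (g (y z) - g (y x)) / (z - x)).
  assert (hQ0 : Q x = d).
  { unfold Q. destruct (excluded_middle_informative (x = x)); tauto. }
  assert (hQ : continuous Q x).
  { apply continuous_eps. intros eps heps. rewrite hQ0.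
    apply is_derive_Reals in hgy.
    destruct (hgy eps heps) as [dl hdl]. apply (locally_intro _ _ dl (cond_pos dl)). intros v hv.
    unfold Q. destruct (excluded_middle_informative (v = x)) as [e|e]; [lra |].
    specialize (hdl (v - x)).
    replace (x + (v - x)) with v in hdl by ring.
    assert (hb : Rabs ((g (y v) - g (y x)) / (v - x) - d) < eps) by (apply hdl; [lra | exact hv]).
    apply Rabs_lt_between in hb. lra. }
  assert (hcont : continuous (fun z => Q z * / k (y z)) x).
  { apply (continuous_mult (K := R_AbsRing)); [exact hQ |].
    apply (continuous_comp (fun z => k (y z)) Rinv); [exact hkc |].
    apply continuity_pt_filterlim. apply continuity_pt_inv.
    - apply derivable_continuous_pt, derivable_pt_id.
    - unfold id. now rewrite hk0. }
  assert (hnz : locally x (fun z => k (y z) <> 0)).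
  { assert (hl' : 0 < Rabs l) by now apply Rabs_pos_lt.
    generalize (continuous_locally (fun z => k (y z)) x _ hl' hkc).
    apply filter_imp. intros z hz. rewrite hk0 in hz. revert hz.
    unfold Rabs. destruct (Rcase_abs l); lra. }
  apply is_derive_Reals. intros eps heps.
  destruct (locally_elim _ _ (filter_and _ _ hnz (continuous_locally _ x eps heps hcont)))
    as [dl [hdl0 hdl]].
  exists (mkposreal dl hdl0). intros h hh hhd.
  destruct (hdl (x + h)) as [h1 h2].
  { now replace (x + h - x) with h by ring. }
  rewrite hk0, hQ0 in h2.
  replace ((y (x + h) - y x) / h) with (Q (x + h) * / k (y (x + h))).
  { apply Rabs_lt_between. unfold Rdiv. lra. }
  unfold Q. destruct (excluded_middle_informative (x + h = x)) as [e|e]; [lra |].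
  revert h1. unfold k.
  destruct (excluded_middle_informative (y (x + h) = y x)) as [e'|e'].
  - intros _. rewrite e'. field. lra.
  - intros h1. replace (x + h - x) with h by ring.
    assert (g (y (x + h)) - g (y x) <> 0).
    { intros h0. apply h1. rewrite h0. unfold Rdiv. ring. }
    field. repeat split; lra.
Qed.

(** The library has [Rpower 0 r = 1]; here the value at [0] must be [0]. *)
Definition pospow (x r : R) : R := if Rlt_dec 0 x then Rpower x r else 0.

Lemma pospow_Rpower (x r : R) : 0 < x -> pospow x r = Rpower x r.
Proof. intros h. unfold pospow. destruct (Rlt_dec 0 x); [reflexivity | lra]. Qed.

Lemma pospow_0 (r : R) : pospow 0 r = 0.
Proof. unfold pospow. destruct (Rlt_dec 0 0); lra. Qed.

Lemma pospow_nonneg (x r : R) : 0 <= pospow x r.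
Proof.
  unfold pospow. destruct (Rlt_dec 0 x); [apply Rlt_le, Rpower_pos | lra].
Qed.

Lemma pospow_lt (x y r : R) : 0 < r -> 0 <= x -> x < y -> pospow x r < pospow y r.
Proof.
  intros hr hx hxy. rewrite (pospow_Rpower y) by lra.
  unfold pospow. destruct (Rlt_dec 0 x); [| apply Rpower_pos].
  apply Rlt_Rpower_l; lra.
Qed.

Lemma pospow_inv (y r : R) : 0 < r -> 0 < y -> pospow (Rpower y (/ r)) r = y.
Proof.
  intros hr hy. rewrite pospow_Rpower by apply Rpower_pos.
  rewrite Rpower_mult, Rinv_l by lra. now apply Rpower_1.
Qed.

Lemma continuous_pospow (x r : R) : 0 < r -> continuous (fun y => pospow y r) x.
Proof.
  intros hr. destruct (Rtotal_order x 0) as [h|[h|h]].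
  - apply (continuous_ext_loc _ (fun _ => 0)); [| apply continuous_const].
    generalize (locally_lt_gt x (x - 1) 0 ltac:(lra)). apply filter_imp. intros y hy.
    unfold pospow. destruct (Rlt_dec 0 y); lra.
  - subst x. apply continuous_eps. intros eps heps. rewrite pospow_0.
    pose proof (Rpower_pos eps (/ r)).
    generalize (locally_lt_gt 0 (-1) (Rpower eps (/ r)) ltac:(lra)).
    apply filter_imp. intros y hy.
    pose proof (pospow_nonneg y r). split; [lra |].
    destruct (Rle_lt_dec y 0).
    + unfold pospow. destruct (Rlt_dec 0 y); lra.
    + rewrite <- (pospow_inv eps r hr heps) at 1.
      assert (pospow y r < pospow (Rpower eps (/ r)) r) by (apply pospow_lt; lra). lra.
  - apply (continuous_ext_loc _ (fun y => Rpower y r)).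
    + generalize (locally_lt_gt x 0 (x + 1) ltac:(lra)). apply filter_imp. intros y hy.
      now rewrite pospow_Rpower.
    + apply continuous_Rpower; [exact h | apply continuous_id].
Qed.

(** * The first integral and its branch [X > m] *)

Section Trajectories.

Variables p be : R.
Hypothesis hp : 1 < p.
Hypothesis hbe : 0 < be.

(** [rho] stands for [V ^ (1 / gamma_exp)]: in this variable the first integral
    [first_int s rho / s] and [total rho = K + V] are continuous up to [rho = 0], and
    [inertia] and [total] are the [m] and [X] above. *)
Definition kap : R := (p - 1) * (1 + be).
Definition inertia (s : R) : R := p - 1 - (p - 2) * s.
Definition lead_exp : R := 2 / (p * (1 + be)).
Definition gamma_exp : R := p * (1 + be) / (2 * be).
Definition total (r : R) : R := kap + pospow r gamma_exp.
Definition lead (r : R) : R := r * Rpower (total r) lead_exp.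
Definition Phi (r : R) : R :=
  (p - 2) * (1 + be) / be * RInt (fun y => Rpower (total y) (lead_exp - 1)) 0 r.
Definition first_int (s r : R) : R := lead r + s * Phi r.
Definition dfirst_int (s r : R) : R := (1 + / be) * Rpower (total r) (lead_exp - 1) * (total r - inertia s).

Lemma gamma_exp_pos : 0 < gamma_exp.
Proof. unfold gamma_exp. apply Rdiv_lt_0_compat; nra. Qed.

Lemma lead_exp_pos : 0 < lead_exp.
Proof. unfold lead_exp. apply Rdiv_lt_0_compat; nra. Qed.

Lemma kap_gt : p - 1 < kap.
Proof. unfold kap. nra. Qed.

Lemma inertia_pos (s : R) : 0 <= s <= 1 -> 0 < inertia s.
Proof.
  intros hs. unfold inertia.
  assert (0 <= (p - 1) * (1 - s)) by (apply Rmult_le_pos; lra).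
  destruct (Req_dec s 1); nra.
Qed.

Lemma total_0 : total 0 = kap.
Proof. unfold total. rewrite pospow_0. lra. Qed.

Lemma total_ge (r : R) : kap <= total r.
Proof. unfold total. pose proof (pospow_nonneg r gamma_exp). lra. Qed.

Lemma total_pos (r : R) : 0 < total r.
Proof. pose proof (total_ge r). pose proof kap_gt. lra. Qed.

Lemma total_lt (r1 r2 : R) : 0 <= r1 -> r1 < r2 -> total r1 < total r2.
Proof.
  intros h1 h2. unfold total. pose proof (pospow_lt r1 r2 gamma_exp gamma_exp_pos h1 h2). lra.
Qed.

Lemma total_le (r1 r2 : R) : 0 <= r1 -> r1 <= r2 -> total r1 <= total r2.
Proof.
  intros h1 [h2|h2]; [apply Rlt_le, total_lt; lra | rewrite h2; lra].
Qed.

Lemma total_onto (x : R) : kap < x -> exists r, 0 < r /\ total r = x.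
Proof.
  intros hx. exists (Rpower (x - kap) (/ gamma_exp)). split; [apply Rpower_pos |].
  unfold total. rewrite pospow_inv; [ring | apply gamma_exp_pos | lra].
Qed.

Lemma continuous_total (r : R) : continuous total r.
Proof.
  apply (continuous_plus (fun _ => kap) (fun r => pospow r gamma_exp)).
  - apply continuous_const.
  - apply continuous_pospow, gamma_exp_pos.
Qed.

Lemma is_derive_total (r : R) : 0 < r -> is_derive total r (gamma_exp * (total r - kap) / r).
Proof.
  intros hr. apply (is_derive_ext_loc (fun z => kap + Rpower z gamma_exp)).
  - generalize (locally_lt_gt r 0 (r + 1) ltac:(lra)). apply filter_imp. intros y hy.
    unfold total. now rewrite pospow_Rpower.
  - evar_last.
    + apply (is_derive_plus (fun _ => kap) (fun z => Rpower z gamma_exp)).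
      * apply is_derive_const.
      * apply (is_derive_Rpower (fun z => z)); [exact hr | apply is_derive_id].
    + unfold total. rewrite pospow_Rpower by exact hr. unfold plus, zero, one; simpl. field. lra.
Qed.

Lemma continuous_powXX (e r : R) : continuous (fun y => Rpower (total y) e) r.
Proof. apply continuous_Rpower; [apply total_pos | apply continuous_total]. Qed.

Lemma is_derive_Phi (r : R) :
  is_derive Phi r ((p - 2) * (1 + be) / be * Rpower (total r) (lead_exp - 1)).
Proof.
  unfold Phi.
  apply (is_derive_scal (fun r => RInt (fun y => Rpower (total y) (lead_exp - 1)) 0 r)).
  apply (is_derive_RInt (fun y => Rpower (total y) (lead_exp - 1)) _ 0 r).
  - apply filter_forall. intros x. apply (RInt_correct (V := R_CompleteNormedModule)), ex_RInt_continuous.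
    intros z _. apply continuous_powXX.
  - apply continuous_powXX.
Qed.

Lemma Phi_0 : Phi 0 = 0.
Proof. unfold Phi. rewrite RInt_point. unfold zero; simpl. ring. Qed.

Lemma lead_0 : lead 0 = 0.
Proof. unfold lead. ring. Qed.

Lemma first_int_0 (s : R) : first_int s 0 = 0.
Proof. unfold first_int. rewrite lead_0, Phi_0. ring. Qed.

Lemma lead_pos (r : R) : 0 < r -> 0 < lead r.
Proof. intros hr. apply Rmult_lt_0_compat; [exact hr | apply Rpower_pos]. Qed.

Lemma Rpower_pred (x e : R) : 0 < x -> Rpower x e = Rpower x (e - 1) * x.
Proof.
  intros hx. rewrite <- (Rpower_1 x hx) at 3. rewrite <- Rpower_plus. f_equal. ring.
Qed.

Definition dlead (r : R) : R := Rpower (total r) (lead_exp - 1) * (total r + (total r - kap) / be).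

Lemma is_derive_lead (r : R) : 0 < r -> is_derive lead r (dlead r).
Proof.
  intros hr. unfold lead. evar_last.
  - apply (is_derive_mult (fun r => r) (fun r => Rpower (total r) lead_exp)).
    + apply is_derive_id.
    + apply is_derive_Rpower; [apply total_pos | now apply is_derive_total].
    + intros; apply Rmult_comm.
  - unfold dlead, plus, mult, one; simpl. pose proof (total_pos r).
    rewrite (Rpower_pred (total r) lead_exp) by assumption.
    unfold lead_exp, gamma_exp. field. repeat split; lra.
Qed.

(** The coefficient in [Phi] is the one for which both terms combine into the single factor
    [total r - inertia s]. Hence [first_int s] starts from [0], decreases while [X < m] and
    increases afterwards. *)
Lemma is_derive_first_int (s r : R) : 0 < r -> is_derive (first_int s) r (dfirst_int s r).
Proof.
  intros hr. unfold first_int. evar_last.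
  - apply (is_derive_plus lead (fun r => s * Phi r)).
    + now apply is_derive_lead.
    + apply (is_derive_scal Phi), is_derive_Phi.
  - unfold dlead, dfirst_int, plus, inertia, kap; simpl. field. lra.
Qed.

Lemma continuous_lead (r : R) : continuous lead r.
Proof.
  apply (continuous_mult (fun r => r) (fun r => Rpower (total r) lead_exp)).
  - apply continuous_id.
  - apply continuous_powXX.
Qed.

Lemma continuous_Phi (r : R) : continuous Phi r.
Proof. eapply is_derive_continuous, is_derive_Phi. Qed.

Lemma continuous_first_int (s r : R) : continuous (first_int s) r.
Proof.
  apply (continuous_plus lead (fun r => s * Phi r)); [apply continuous_lead |].
  apply (continuous_scal_r s Phi), continuous_Phi.
Qed.

Lemma dfirst_int_pos (s r : R) : inertia s < total r -> 0 < dfirst_int s r.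
Proof.
  intros h. unfold dfirst_int. apply Rmult_lt_0_compat; [| lra].
  apply Rmult_lt_0_compat; [| apply Rpower_pos].
  pose proof (Rinv_0_lt_compat be hbe). lra.
Qed.

Lemma first_int_lt (s r1 r2 : R) : 0 <= r1 -> r1 < r2 -> inertia s <= total r1 -> first_int s r1 < first_int s r2.
Proof.
  intros h1 h2 h3. apply (derive_pos_lt (first_int s) (dfirst_int s)); [exact h2 | | |].
  - intros z hz. apply is_derive_first_int. lra.
  - intros z hz. apply dfirst_int_pos. pose proof (total_lt r1 z h1 ltac:(lra)). lra.
  - intros z _. apply continuous_first_int.
Qed.

Lemma first_int_neg (s r : R) : 0 < r -> total r <= inertia s -> first_int s r < 0.
Proof.
  intros h1 h2. rewrite <- (first_int_0 s).
  enough (- first_int s 0 < - first_int s r) by lra.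
  apply (derive_pos_lt (fun r => - first_int s r) (fun r => - dfirst_int s r)); [exact h1 | | |].
  - intros z hz. apply (is_derive_opp (first_int s)). apply is_derive_first_int. lra.
  - intros z hz. pose proof (total_lt z r ltac:(lra) ltac:(lra)). unfold dfirst_int.
    pose proof (Rinv_0_lt_compat be hbe).
    assert (0 < (1 + / be) * Rpower (total z) (lead_exp - 1))
      by (apply Rmult_lt_0_compat; [lra | apply Rpower_pos]).
    nra.
  - intros z _. apply (continuous_opp (first_int s)), continuous_first_int.
Qed.

Lemma first_int_pos (s r : R) : 0 < r -> inertia s <= kap -> 0 < first_int s r.
Proof.
  intros h1 h2. rewrite <- (first_int_0 s). apply first_int_lt; [lra | exact h1 | now rewrite total_0].
Qed.

(** Once [X >= 2], one has [X - 1 >= X / 2], so the derivative stays above the constant [d] and the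
    growth is at least linear. The case [s = 1] controls the others, since
    [first_int s r >= s * first_int 1 r] for [0 <= s <= 1]. *)
Lemma first_int_unbounded (h : R) : exists r, 0 < r /\ h <= first_int 1 r.
Proof.
  destruct (total_onto (kap + 2)) as [r0 [hr0 hX0]]; [lra |].
  pose proof kap_gt as hK.
  set (d := (1 + / be) * / 2 * Rpower kap lead_exp).
  assert (hib : 0 < / be) by now apply Rinv_0_lt_compat.
  assert (hd : 0 < d).
  { apply Rmult_lt_0_compat; [lra | apply Rpower_pos]. }
  set (y := (Rabs h + Rabs (first_int 1 r0)) / d).
  assert (hy : 0 <= y).
  { apply Rdiv_le_0_compat; [| exact hd].
    pose proof (Rabs_pos h). pose proof (Rabs_pos (first_int 1 r0)). lra. }
  assert (hdy : d * y = Rabs h + Rabs (first_int 1 r0)) by (unfold y; field; lra).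
  exists (r0 + y). split; [lra |].
  assert (first_int 1 r0 - d * r0 <= first_int 1 (r0 + y) - d * (r0 + y)).
  { apply (derive_nonneg_le (fun r => first_int 1 r - d * r) (fun r => dfirst_int 1 r - d)); [lra | |].
    - intros z hz. apply (is_derive_minus (first_int 1) (fun r => d * r)).
      + apply is_derive_first_int. lra.
      + evar_last; [apply (is_derive_scal (fun r => r)), is_derive_id |].
        unfold one; simpl. ring.
    - intros z hz. unfold dfirst_int, d.
      assert (hX : kap + 2 <= total z) by (rewrite <- hX0; apply total_le; lra).
      replace (inertia 1) with 1 by (unfold inertia; ring).
      assert (hle : Rpower kap lead_exp <= Rpower (total z) lead_exp).
      { apply Rle_Rpower_l; [apply Rlt_le, lead_exp_pos | lra]. }
      rewrite (Rpower_pred (total z) lead_exp) in hle by lra.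
      pose proof (Rpower_pos (total z) (lead_exp - 1)) as hpw.
      revert hle hpw. generalize (Rpower (total z) (lead_exp - 1)) (Rpower kap lead_exp). intros u v hle hpw.
      assert (/ 2 * v <= u * (total z - 1)) by nra.
      assert (0 <= (1 + / be) * (u * (total z - 1) - / 2 * v)) by (apply Rmult_le_pos; lra).
      lra. }
  pose proof (Rle_abs h). pose proof (Rle_abs (- first_int 1 r0)) as ha. rewrite Rabs_Ropp in ha. lra.
Qed.

(** An intermediate value lies on the branch [X > m] because the other branch only carries values at
    most [0], below [s * h]. At [s = 0] the root is [0], where [X = K > p - 1 = m]. *)
Lemma rho_exists (s h : R) : 0 < h -> 0 <= s <= 1 ->
  exists r, 0 <= r /\ first_int s r = s * h /\ inertia s < total r.
Proof.
  intros hh hs. destruct (Rle_lt_or_eq_dec 0 s ltac:(lra)) as [h0|h0].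
  - destruct (first_int_unbounded h) as [r1 [hr1 hP1]].
    assert (hP : s * h <= first_int s r1).
    { unfold first_int in *. pose proof (lead_pos r1 hr1). nra. }
    destruct (IVT_gen (first_int s) 0 r1 (s * h)) as [r [hr hPr]].
    + intros z. apply continuity_pt_filterlim, continuous_first_int.
    + rewrite first_int_0, Rmin_left, Rmax_right by nra. nra.
    + rewrite Rmin_left in hr by lra. exists r. repeat split; [lra | exact hPr |].
      apply Rnot_le_lt. intros hX.
      destruct (Rle_lt_or_eq_dec 0 r ltac:(lra)) as [hr0|hr0].
      * pose proof (first_int_neg s r hr0 hX). nra.
      * subst r. rewrite first_int_0 in hPr. nra.
  - subst s. exists 0. repeat split; [lra | rewrite first_int_0; ring |].
    rewrite total_0. unfold inertia. pose proof kap_gt. lra.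
Qed.

Definition rho (s h : R) : R :=
  epsilon (inhabits 0) (fun r => 0 <= r /\ first_int s r = s * h /\ inertia s < total r).

Lemma rho_spec (s h : R) : 0 < h -> 0 <= s <= 1 ->
  0 <= rho s h /\ first_int s (rho s h) = s * h /\ inertia s < total (rho s h).
Proof.
  intros hh hs.
  exact (epsilon_spec (inhabits 0) (fun r => 0 <= r /\ first_int s r = s * h /\ inertia s < total r)
           (rho_exists s h hh hs)).
Qed.

Lemma rho_lt_first_int (s h r : R) : 0 < h -> 0 <= s <= 1 -> rho s h < r -> s * h < first_int s r.
Proof.
  intros hh hs hr. destruct (rho_spec s h hh hs) as [h1 [h2 h3]].
  rewrite <- h2. apply first_int_lt; lra.
Qed.

(** Left of the root [first_int s] need not be monotone; where [X < m], its sign replaces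
    monotonicity. *)
Lemma first_int_lt_rho (s h r : R) : 0 < h -> 0 <= s <= 1 -> 0 <= r < rho s h -> first_int s r < s * h.
Proof.
  intros hh hs hr. destruct (rho_spec s h hh hs) as [h1 [h2 h3]].
  destruct (Rle_lt_dec (inertia s) (total r)) as [hX|hX].
  - rewrite <- h2. apply first_int_lt; lra.
  - destruct (Rle_lt_or_eq_dec 0 s ltac:(lra)) as [h0|h0].
    + destruct (Rle_lt_or_eq_dec 0 r ltac:(lra)) as [hr0|hr0].
      * pose proof (first_int_neg s r hr0 ltac:(lra)). nra.
      * subst r. rewrite first_int_0. nra.
    + subst s. unfold inertia in hX. pose proof kap_gt. pose proof (total_ge r). lra.
Qed.

Lemma rho_unique (s h r : R) : 0 < h -> 0 <= s <= 1 -> 0 <= r -> first_int s r = s * h ->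
  inertia s < total r -> r = rho s h.
Proof.
  intros hh hs hr hP hX.
  destruct (Rtotal_order r (rho s h)) as [h0|[h0|h0]]; [| exact h0 |].
  - pose proof (first_int_lt_rho s h r hh hs ltac:(lra)). lra.
  - pose proof (rho_lt_first_int s h r hh hs ltac:(lra)). lra.
Qed.

Lemma rho_pos (s h : R) : 0 < h -> 0 < s <= 1 -> 0 < rho s h.
Proof.
  intros hh hs. destruct (rho_spec s h hh ltac:(lra)) as [h1 [h2 h3]].
  destruct h1 as [h1|h1]; [exact h1 |].
  rewrite <- h1, first_int_0 in h2. nra.
Qed.

Lemma rho_0 (h : R) : 0 < h -> rho 0 h = 0.
Proof.
  intros hh. symmetry. apply rho_unique; [exact hh | lra | lra | rewrite first_int_0; ring |].
  rewrite total_0. unfold inertia. pose proof kap_gt. lra.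
Qed.

Lemma rho_le_of_first_int (s h r : R) : 0 < h -> 0 <= s <= 1 -> s * h <= first_int s r -> 0 <= r -> rho s h <= r.
Proof.
  intros hh hs hP hr. apply Rnot_lt_le. intros hn.
  pose proof (first_int_lt_rho s h r hh hs ltac:(lra)). lra.
Qed.

Lemma rho_ge_of_first_int (s h r : R) : 0 < h -> 0 <= s <= 1 -> first_int s r <= s * h -> r <= rho s h.
Proof.
  intros hh hs hP. apply Rnot_lt_le. intros hn.
  pose proof (rho_lt_first_int s h r hh hs hn). lra.
Qed.

Lemma rho_le (s h1 h2 : R) : 0 < h1 -> h1 <= h2 -> 0 <= s <= 1 -> rho s h1 <= rho s h2.
Proof.
  intros hh h12 hs. destruct (rho_spec s h1 hh hs) as [h3 [h4 h5]].
  apply rho_ge_of_first_int; [lra | exact hs |]. rewrite h4. nra.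
Qed.


(** * The length of the arc as a function of the level [h] *)

Definition cos_sq (al : R) : R := cos al ^ 2.
Definition rho_at (al h : R) : R := rho (cos_sq al) h.
Definition time_density (al h : R) : R := inertia (cos_sq al) / (total (rho_at al h) - inertia (cos_sq al)).
(** Since [time_density] is [-1 / al'], this is the time needed to descend from [al] to [-PI/2]; at
    [al = PI/2] it is the length of the arc. *)
Definition Theta (h al : R) : R := RInt (fun z => time_density z h) (- (PI / 2)) al.

Lemma cos_sq_bound (al : R) : 0 <= cos_sq al <= 1.
Proof. unfold cos_sq. pose proof (COS_bound al). split; nra. Qed.

Lemma inertia_le (s : R) : 0 <= s <= 1 -> inertia s <= p.
Proof. intros hs. unfold inertia. nra. Qed.

Lemma continuity_2d_pos (f : R -> R -> R) (x y : R) :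
  continuity_2d_pt f x y -> 0 < f x y -> locally_2d (fun u v => 0 < f u v) x y.
Proof.
  intros hc hf. destruct (hc (mkposreal _ hf)) as [d hd]. exists d.
  intros u v hu hv. specialize (hd u v hu hv). simpl in hd.
  apply Rabs_lt_between in hd. lra.
Qed.

Lemma continuity_cos_sq (al : R) : continuity_pt cos_sq al.
Proof.
  apply continuity_pt_filterlim.
  apply (continuous_mult cos (fun al => cos al * 1)).
  - apply continuity_pt_filterlim, continuity_cos.
  - apply (continuous_mult cos (fun _ => 1)).
    + apply continuity_pt_filterlim, continuity_cos.
    + apply continuous_const.
Qed.

Lemma continuity_2d_cos_sq (al h : R) : continuity_2d_pt (fun u _ => cos_sq u) al h.
Proof.
  apply (continuity_1d_2d_pt_comp cos_sq (fun u _ => u)).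
  - apply continuity_cos_sq.
  - apply continuity_2d_pt_id1.
Qed.

(** The strict inequalities between [first_int] and [s * h] at [r0 - eps/2] and [r0 + eps/2] persist
    for nearby angles and levels, and trap the root in between. This also covers the end angles,
    where the root is [0] and [total] need not be differentiable. *)
Lemma continuity_2d_rho_at (al h : R) : 0 < h -> continuity_2d_pt rho_at al h.
Proof.
  intros hh eps. set (r0 := rho_at al h).
  assert (hF : forall r, continuity_2d_pt (fun u v => first_int (cos_sq u) r - cos_sq u * v) al h).
  { intros r. unfold first_int. apply continuity_2d_pt_minus.
    - apply continuity_2d_pt_plus; [apply continuity_2d_pt_const |].
      apply continuity_2d_pt_mult; [apply continuity_2d_cos_sq | apply continuity_2d_pt_const].
    - apply continuity_2d_pt_mult; [apply continuity_2d_cos_sq | apply continuity_2d_pt_id2]. }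
  pose proof (cond_pos eps) as he.
  pose proof (rho_spec (cos_sq al) h hh (cos_sq_bound al)) as [hr0 _]. fold (rho_at al h) r0 in hr0.
  assert (h1 : locally_2d (fun u v => 0 < first_int (cos_sq u) (r0 + eps / 2) - cos_sq u * v) al h).
  { apply (continuity_2d_pos (fun u v => first_int (cos_sq u) (r0 + eps / 2) - cos_sq u * v)); [apply hF |].
    enough (cos_sq al * h < first_int (cos_sq al) (r0 + eps / 2)) by lra.
    apply rho_lt_first_int; [exact hh | apply cos_sq_bound |]. fold (rho_at al h) r0. lra. }
  assert (h2 : locally_2d (fun u v => 0 < v) al h).
  { apply (continuity_2d_pos (fun _ v => v)); [apply continuity_2d_pt_id2 | exact hh]. }
  (* A negative lower barrier needs no inequality, the root being nonnegative. *)
  assert (h3 : r0 - eps / 2 < 0 \/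
    locally_2d (fun u v => 0 < - (first_int (cos_sq u) (r0 - eps / 2) - cos_sq u * v)) al h).
  { destruct (Rlt_le_dec (r0 - eps / 2) 0) as [h0|h0]; [now left | right].
    apply (continuity_2d_pos (fun u v => - (first_int (cos_sq u) (r0 - eps / 2) - cos_sq u * v))).
    - apply continuity_2d_pt_opp, hF.
    - enough (first_int (cos_sq al) (r0 - eps / 2) < cos_sq al * h) by lra.
      apply first_int_lt_rho; [exact hh | apply cos_sq_bound |]. fold (rho_at al h) r0. lra. }
  destruct h1 as [d1 h1], h2 as [d2 h2].
  assert (h4 : exists d3 : posreal, forall u v, Rabs (u - al) < d3 -> Rabs (v - h) < d3 ->
     0 < v -> r0 - eps / 2 <= rho_at u v).
  { destruct h3 as [h3|[d3 h3]].
    - exists d1. intros u v _ _ hv.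
      pose proof (rho_spec (cos_sq u) v hv (cos_sq_bound u)) as [hr _]. unfold rho_at. lra.
    - exists d3. intros u v hu hv hv0. apply rho_ge_of_first_int; [exact hv0 | apply cos_sq_bound |].
      specialize (h3 u v hu hv). lra. }
  destruct h4 as [d3 h4].
  assert (hd : 0 < Rmin d1 (Rmin d2 d3)) by (repeat apply Rmin_pos; apply cond_pos).
  exists (mkposreal _ hd). simpl. intros u v hu hv.
  pose proof (Rmin_l d1 (Rmin d2 d3)). pose proof (Rmin_r d1 (Rmin d2 d3)).
  pose proof (Rmin_l d2 d3). pose proof (Rmin_r d2 d3).
  assert (hv0 : 0 < v) by (apply (h2 u v); lra).
  assert (hlo : r0 - eps / 2 <= rho_at u v) by (apply h4; lra).
  assert (hhi : rho_at u v <= r0 + eps / 2).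
  { apply rho_le_of_first_int; [exact hv0 | apply cos_sq_bound | | lra].
    enough (0 < first_int (cos_sq u) (r0 + eps / 2) - cos_sq u * v) by lra. apply h1; lra. }
  fold r0. apply Rabs_lt_between. lra.
Qed.

Lemma rho_at_spec (al h : R) : 0 < h ->
  0 <= rho_at al h /\ first_int (cos_sq al) (rho_at al h) = cos_sq al * h /\ inertia (cos_sq al) < total (rho_at al h).
Proof. intros hh. apply rho_spec; [exact hh | apply cos_sq_bound]. Qed.

Lemma continuity_2d_time_density (al h : R) : 0 < h -> continuity_2d_pt time_density al h.
Proof.
  intros hh.
  assert (hm : continuity_2d_pt (fun u _ => inertia (cos_sq u)) al h).
  { unfold inertia. apply continuity_2d_pt_minus; [apply continuity_2d_pt_const |].
    apply continuity_2d_pt_mult; [apply continuity_2d_pt_const | apply continuity_2d_cos_sq]. }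
  apply (continuity_2d_pt_mult (fun u _ => inertia (cos_sq u)) (fun u v => / (total (rho_at u v) - inertia (cos_sq u)))).
  - exact hm.
  - apply continuity_2d_pt_inv.
    + apply continuity_2d_pt_minus; [| exact hm].
      apply (continuity_1d_2d_pt_comp total rho_at).
      * apply continuity_pt_filterlim, continuous_total.
      * now apply continuity_2d_rho_at.
    + pose proof (rho_at_spec al h hh). lra.
Qed.

Lemma continuity_2d_slice (f : R -> R -> R) (x y : R) :
  continuity_2d_pt f x y -> continuous (fun u => f u y) x.
Proof.
  intros hf. apply continuous_eps. intros eps heps.
  destruct (hf (mkposreal eps heps)) as [d hd]. apply (locally_intro _ _ d (cond_pos d)).
  intros v hv. specialize (hd v y hv). simpl in hd.
  assert (hb : Rabs (f v y - f x y) < eps).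
  { apply hd. rewrite Rminus_diag, Rabs_R0. apply cond_pos. }
  apply Rabs_lt_between in hb. lra.
Qed.

Lemma continuous_rho_at (al h : R) : 0 < h -> continuous (fun u => rho_at u h) al.
Proof. intros hh. now apply continuity_2d_slice, continuity_2d_rho_at. Qed.

Lemma continuous_time_density (al h : R) : 0 < h -> continuous (fun u => time_density u h) al.
Proof. intros hh. now apply continuity_2d_slice, continuity_2d_time_density. Qed.

Lemma time_density_pos (al h : R) : 0 < h -> 0 < time_density al h.
Proof.
  intros hh. pose proof (rho_at_spec al h hh). pose proof (inertia_pos (cos_sq al) (cos_sq_bound al)).
  apply Rdiv_lt_0_compat; lra.
Qed.

Lemma Rdiv_le_compat (a b c d : R) : 0 <= a -> a <= c -> 0 < d -> d <= b -> a / b <= c / d.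
Proof.
  intros h1 h2 h3 h4. unfold Rdiv. apply Rmult_le_compat; [exact h1 | | exact h2 |].
  - apply Rlt_le, Rinv_0_lt_compat. lra.
  - now apply Rinv_le_contravar.
Qed.

Lemma time_density_decr (al h1 h2 : R) : 0 < h1 -> h1 <= h2 -> time_density al h2 <= time_density al h1.
Proof.
  intros hh h12. pose proof (rho_at_spec al h1 hh). pose proof (inertia_pos (cos_sq al) (cos_sq_bound al)).
  pose proof (rho_le (cos_sq al) h1 h2 hh h12 (cos_sq_bound al)).
  assert (total (rho_at al h1) <= total (rho_at al h2)) by (apply total_le; [tauto | assumption]).
  apply Rdiv_le_compat; lra.
Qed.

Lemma ex_RInt_time_density (h x y : R) : 0 < h -> ex_RInt (fun z => time_density z h) x y.
Proof. intros hh. apply (ex_RInt_continuous (V := R_CompleteNormedModule)).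
  intros z _. now apply continuous_time_density. Qed.

Lemma is_derive_Theta (h al : R) : 0 < h -> is_derive (Theta h) al (time_density al h).
Proof.
  intros hh. apply (is_derive_RInt (fun z => time_density z h) _ (- (PI / 2)) al).
  - apply filter_forall. intros x. apply (RInt_correct (V := R_CompleteNormedModule)).
    now apply ex_RInt_time_density.
  - now apply continuous_time_density.
Qed.

Lemma continuous_Theta (h al : R) : 0 < h -> continuous (Theta h) al.
Proof. intros hh. eapply is_derive_continuous. now apply is_derive_Theta. Qed.

Lemma Theta_lt (h x y : R) : 0 < h -> x < y -> Theta h x < Theta h y.
Proof.
  intros hh hxy. apply (derive_pos_lt (Theta h) (fun z => time_density z h)); [exact hxy | | |].
  - intros z _. now apply is_derive_Theta.
  - intros z _. now apply time_density_pos.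
  - intros z _. now apply continuous_Theta.
Qed.

Lemma Theta_start (h : R) : Theta h (- (PI / 2)) = 0.
Proof. unfold Theta. now rewrite RInt_point. Qed.

Lemma continuous_length (h : R) : 0 < h -> continuous (fun h => Theta h (PI / 2)) h.
Proof.
  intros hh. apply continuous_eps. intros eps heps. pose proof PI_RGT_0 as hpi.
  assert (he' : 0 < eps / (2 * PI)) by (apply Rdiv_lt_0_compat; lra).
  destruct (uniform_continuity_2d_1d time_density (- (PI / 2)) (PI / 2) h
    (fun x _ => continuity_2d_time_density x h hh) (mkposreal _ he')) as [d hd]. simpl in hd.
  assert (hd' : 0 < Rmin d h) by (apply Rmin_pos; [apply cond_pos | exact hh]).
  apply (locally_intro _ _ _ hd'). intros v hv. apply Rabs_lt_between in hv.
  pose proof (Rmin_l d h). pose proof (Rmin_r d h). pose proof (cond_pos d).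
  assert (hv0 : 0 < v) by lra.
  enough (hb : Rabs (Theta v (PI / 2) - Theta h (PI / 2)) <= eps / 2).
  { apply Rabs_le_between in hb. lra. }
  unfold Theta.
  rewrite <- (RInt_minus (V := R_CompleteNormedModule) (fun z => time_density z v) (fun z => time_density z h))
    by now apply ex_RInt_time_density.
  replace (eps / 2) with ((PI / 2 - - (PI / 2)) * (eps / (2 * PI))) by (field; lra).
  apply abs_RInt_le_const; [lra | |].
  - apply (ex_RInt_minus (V := R_CompleteNormedModule)); now apply ex_RInt_time_density.
  - intros t ht. apply Rlt_le. apply hd; try lra.
    rewrite Rminus_diag, Rabs_R0. lra.
Qed.

Lemma Theta_diff_le (h x y M : R) : 0 < h -> x <= y ->
  (forall t, x <= t <= y -> time_density t h <= M) -> Theta h y - Theta h x <= (y - x) * M.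
Proof.
  intros hh hxy hM.
  enough (M * x - Theta h x <= M * y - Theta h y) by lra.
  apply (derive_nonneg_le (fun z => M * z - Theta h z) (fun z => M - time_density z h)); [exact hxy | |].
  - intros z _. apply (is_derive_minus (fun z => M * z) (Theta h)).
    + evar_last; [apply (is_derive_scal (fun r => r)), is_derive_id |].
      unfold one; simpl. ring.
    + now apply is_derive_Theta.
  - intros z hz. specialize (hM z hz). lra.
Qed.

(** Within [e] of either end the density is at most [C], its maximum at level [1], because it
    decreases in the level. In between, [s >= s0 > 0], and a high level forces [X] to be large and
    the density to be at most [d]. The three contributions are at most [l/8], [l/4] and [l/8]. *)
Lemma length_small (l : R) : 0 < l -> exists h, 0 < h /\ Theta h (PI / 2) < l.
Proof.
  intros hl. pose proof PI_RGT_0 as hpi.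
  destruct (continuity_ab_maj (fun al => time_density al 1) (- (PI / 2)) (PI / 2)) as [x0 [hx0 _]].
  { lra. }
  { intros c _. apply continuity_pt_filterlim, continuous_time_density, Rlt_0_1. }
  set (C := time_density x0 1) in hx0.
  assert (hC : 0 < C) by (apply time_density_pos; lra).
  set (e := Rmin (PI / 4) (l / (8 * C))).
  assert (he1 : e <= PI / 4) by apply Rmin_l.
  assert (he2 : e <= l / (8 * C)) by apply Rmin_r.
  assert (he : 0 < e).
  { apply Rmin_pos; [lra |]. apply Rdiv_lt_0_compat; lra. }
  assert (heC : e * C <= l / 8).
  { replace (l / 8) with (l / (8 * C) * C) by (field; lra). apply Rmult_le_compat_r; lra. }
  set (d := l / (4 * PI)).
  assert (hd : 0 < d) by (apply Rdiv_lt_0_compat; lra).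
  (* As [m <= p], having [X >= K + M] leaves [X - m >= p / d], hence a density of at most [d]. *)
  set (M := p + p / d).
  assert (hM : 0 < p / d) by (apply Rdiv_lt_0_compat; lra).
  pose proof kap_gt as hK.
  destruct (total_onto (kap + M)) as [r [hr hXr]]; [unfold M; lra |].
  set (s0 := sin e ^ 2).
  assert (hsin : 0 < sin e) by (apply sin_gt_0; lra).
  assert (hs0 : 0 < s0) by (unfold s0; nra).
  (* Then [s * h >= lead r + s * Phi r] whenever [s >= s0], which puts the root above [r]. *)
  set (h := 1 + lead r / s0 + Rabs (Phi r)).
  assert (hA : 0 < lead r / s0) by (apply Rdiv_lt_0_compat; [now apply lead_pos | exact hs0]).
  pose proof (Rabs_pos (Phi r)) as hPhi. pose proof (Rle_abs (Phi r)) as hPhi'.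
  assert (hh : 1 <= h) by (unfold h; lra).
  assert (hbound : forall t, - (PI / 2) <= t <= PI / 2 -> time_density t h <= C).
  { intros t ht. apply Rle_trans with (time_density t 1); [apply time_density_decr; lra | now apply hx0]. }
  assert (hin : forall t, - (PI / 2) + e <= t <= PI / 2 - e -> time_density t h <= d).
  { intros t ht.
    assert (hcos : sin e <= cos t).
    { rewrite <- cos_shift. destruct (Rle_lt_dec 0 t).
      - apply cos_decr_1; lra.
      - rewrite <- (cos_neg t). apply cos_decr_1; lra. }
    assert (hst : s0 <= cos_sq t) by (unfold s0, cos_sq; nra).
    pose proof (cos_sq_bound t) as hb.
    assert (hrr : r <= rho_at t h).
    { apply rho_ge_of_first_int; [lra | exact hb |]. unfold first_int, h.
      assert (lead r <= cos_sq t * (lead r / s0)).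
      { replace (lead r) with (s0 * (lead r / s0)) at 1 by (field; lra).
        apply Rmult_le_compat_r; lra. }
      nra. }
    assert (hX : kap + M <= total (rho_at t h)) by (rewrite <- hXr; apply total_le; lra).
    pose proof (inertia_le (cos_sq t) hb). pose proof (inertia_pos (cos_sq t) hb).
    replace d with (p / (p / d)) by (field; lra).
    apply Rdiv_le_compat; [lra | lra | lra |]. unfold M in hX. lra. }
  exists h. split; [lra |].
  pose proof (Theta_diff_le h (- (PI / 2)) (- (PI / 2) + e) C ltac:(lra) ltac:(lra)
    ltac:(intros; apply hbound; lra)) as b1.
  pose proof (Theta_diff_le h (- (PI / 2) + e) (PI / 2 - e) d ltac:(lra) ltac:(lra) hin) as b2.
  pose proof (Theta_diff_le h (PI / 2 - e) (PI / 2) C ltac:(lra) ltac:(lra)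
    ltac:(intros; apply hbound; lra)) as b3.
  rewrite Theta_start in b1.
  assert (PI * d = l / 4) by (unfold d; field; lra).
  nra.
Qed.

(** The quotient [first_int s r / s = lead r / s + Phi r] decreases in [s], so the level for which
    [r] is the root at [s0] has its roots below [r] for all smaller [s]. The bound on [inertia s0]
    makes this level positive. *)
Lemma total_rho_small (s0 r : R) : 0 < s0 <= 1 -> inertia s0 <= kap -> 0 < r ->
  exists h, 0 < h /\ forall s, 0 <= s <= s0 -> total (rho s h) <= total r.
Proof.
  intros hs0 hm hr. pose proof (first_int_pos s0 r hr hm) as hP.
  set (h := first_int s0 r / s0).
  assert (hh : 0 < h) by (apply Rdiv_lt_0_compat; lra).
  exists h. split; [exact hh |]. intros s hs.
  apply total_le; [apply rho_spec; lra |].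
  apply rho_le_of_first_int; [exact hh | lra | | lra].
  assert (he : s0 * h = first_int s0 r) by (unfold h; field; lra).
  pose proof (lead_pos r hr). unfold first_int in *. nra.
Qed.

(** The point [V = 0], [s = s0] with [m = K] is an equilibrium of the system, and [kap <= 1] says
    that [s0 <= 1], so that it exists. At a low level the trajectory lingers near it: on
    [[a0, PI/2]] one has [X - m <= e + 2 (al - a0)], so the time spent grows at least like the
    logarithm of [1/e]. *)
Lemma length_large (l : R) : kap <= 1 -> exists h, 0 < h /\ l <= Theta h (PI / 2).
Proof.
  intros hK1. pose proof PI_RGT_0 as hpi. pose proof kap_gt as hK.
  assert (hp2 : p < 2) by lra.
  set (s0 := (p - 1) * be / (2 - p)).
  assert (hs0' : s0 * (2 - p) = (p - 1) * be) by (unfold s0; field; lra).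
  assert (hs0 : 0 < s0) by (apply Rdiv_lt_0_compat; nra).
  assert (hs1 : s0 <= 1).
  { unfold kap in hK1. nra. }
  assert (hm0 : inertia s0 = kap) by (unfold inertia, kap; lra).
  assert (hq : 0 < sqrt s0) by now apply sqrt_lt_R0.
  assert (hq1 : sqrt s0 <= 1) by (rewrite <- sqrt_1; now apply sqrt_le_1_alt).
  assert (hqq : sqrt s0 * sqrt s0 = s0) by (apply sqrt_sqrt; lra).
  set (a0 := acos (sqrt s0)).
  assert (hcos : cos a0 = sqrt s0) by (apply cos_acos; lra).
  assert (ha0 : 0 <= a0 < PI / 2).
  { pose proof (acos_bound (sqrt s0)) as hb. fold a0 in hb. split; [lra |].
    apply Rnot_le_lt. intros hn. pose proof (cos_le_0 a0 hn ltac:(lra)). lra. }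
  set (d := 2 * (PI / 2 - a0)).
  assert (hd : 0 < d) by (unfold d; lra).
  (* Chosen so that [(p-1)/2 * ln (d / e) = l]. *)
  set (e := d * exp (- (2 * l / (p - 1)))).
  assert (he : 0 < e) by (apply Rmult_lt_0_compat; [exact hd | apply exp_pos]).
  destruct (total_onto (kap + e)) as [r [hr hXr]]; [lra |].
  destruct (total_rho_small s0 r ltac:(lra) ltac:(lra) hr) as [h [hh hX]].
  exists h. split; [exact hh |].
  assert (hcl : forall t, a0 <= t -> cos a0 - cos t <= t - a0).
  { intros t ht. enough (a0 + cos a0 <= t + cos t) by lra.
    apply (derive_nonneg_le (fun t => t + cos t) (fun t => 1 + - sin t)); [exact ht | |].
    - intros z _. auto_derive; [exact I | ring].
    - intros z _. pose proof (SIN_bound z). lra. }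
  set (c := (p - 1) / 2).
  (* The logarithm is a primitive of [(p-1) / (e + 2 (t - a0))], a lower bound for the density
     because [m >= p - 1] and [2 - p <= 1]. *)
  assert (hmono : Theta h a0 - c * ln (e + 2 * (a0 - a0)) <=
                  Theta h (PI / 2) - c * ln (e + 2 * (PI / 2 - a0))).
  { apply (derive_nonneg_le (fun t => Theta h t - c * ln (e + 2 * (t - a0)))
      (fun t => time_density t h - (p - 1) / (e + 2 * (t - a0)))); [lra | |].
    - intros z hz. apply (is_derive_minus (Theta h) (fun t => c * ln (e + 2 * (t - a0)))).
      + now apply is_derive_Theta.
      + auto_derive; [lra |]. unfold c. field. lra.
    - intros z hz.
      assert (hc0 : 0 <= cos z) by (apply cos_ge_0; lra).
      assert (hcz : cos z <= cos a0) by (apply cos_decr_1; lra).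
      pose proof (hcl z ltac:(lra)) as hlip.
      assert (hsz : s0 - cos_sq z <= 2 * (z - a0)).
      { unfold cos_sq. rewrite <- hqq, <- hcos.
        replace (cos a0 * cos a0 - cos z ^ 2) with ((cos a0 - cos z) * (cos a0 + cos z)) by ring.
        rewrite hcos in *. nra. }
      assert (hsz0 : cos_sq z <= s0) by (unfold cos_sq; rewrite <- hqq, <- hcos; nra).
      pose proof (cos_sq_bound z) as hb.
      pose proof (hX (cos_sq z) ltac:(lra)) as hXz. fold (rho_at z h) in hXz.
      pose proof (rho_at_spec z h hh) as [_ [_ hXm]].
      enough ((p - 1) / (e + 2 * (z - a0)) <= time_density z h) by lra.
      apply Rdiv_le_compat; [lra | unfold inertia; nra | lra |].
      rewrite hXr in hXz.
      assert (kap - inertia (cos_sq z) = (2 - p) * (s0 - cos_sq z)) by (rewrite <- hm0; unfold inertia; ring).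
      nra. }
  assert (h0 : 0 <= Theta h a0).
  { rewrite <- (Theta_start h). apply Rlt_le, Theta_lt; lra. }
  replace (e + 2 * (a0 - a0)) with e in hmono by ring. fold d in hmono.
  assert (hln : ln e = ln d - 2 * l / (p - 1)).
  { unfold e. rewrite ln_mult, ln_exp by (try apply exp_pos; lra). ring. }
  assert (hln2 : ln d <= ln (e + d)) by (apply Rlt_le, ln_increasing; lra).
  assert (hcl2 : c * (2 * l / (p - 1)) = l) by (unfold c; field; lra).
  assert (0 < c) by (unfold c; lra).
  rewrite hln in hmono. nra.
Qed.

Lemma length_onto (l h1 : R) : 0 < l -> 0 < h1 -> l <= Theta h1 (PI / 2) ->
  exists h, 0 < h /\ Theta h (PI / 2) = l.
Proof.
  intros hl hh1 hl1. destruct (length_small l hl) as [h2 [hh2 hl2]].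
  destruct hl1 as [hl1|hl1]; [| now exists h1].
  assert (h12 : h1 < h2).
  { apply Rnot_le_lt. intros hn.
    enough (Theta h1 (PI / 2) <= Theta h2 (PI / 2)) by lra.
    apply RInt_le; [pose proof PI_RGT_0; lra | now apply ex_RInt_time_density | now apply ex_RInt_time_density |].
    intros x _. now apply time_density_decr. }
  destruct (Ranalysis5.IVT_interv (fun h => l - Theta h (PI / 2)) h1 h2) as [h [hh hr]].
  - intros z hz. apply continuity_pt_filterlim.
    apply (continuous_minus (fun _ => l) (fun h => Theta h (PI / 2))).
    + apply continuous_const.
    + apply continuous_length. lra.
  - exact h12.
  - lra.
  - lra.
  - exists h. split; lra.
Qed.

(** * The equation in terms of the slope and the angle *)

Definition slope (w : R -> R) (x : R) : R := Derive w x / (be * w x).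
(** By homogeneity the flux divided by [(be w)^(p-1)] depends on the slope [t] alone, through this
    function, strictly increasing because [p > 1]. *)
Definition flux_slope (t : R) : R := t * Rpower (1 + t ^ 2) (p / 2 - 1).

Lemma is_derive_flux_slope (t : R) :
  is_derive flux_slope t (Rpower (1 + t ^ 2) (p / 2 - 1) * (1 + (p - 1) * t ^ 2) / (1 + t ^ 2)).
Proof.
  assert (ht : 0 < 1 + t ^ 2) by nra.
  unfold flux_slope. evar_last.
  - apply (is_derive_mult (fun t => t) (fun t => Rpower (1 + t ^ 2) (p / 2 - 1))).
    + apply is_derive_id.
    + apply (is_derive_Rpower (fun t => 1 + t ^ 2) t (2 * t)); [exact ht |].
      auto_derive; [exact I | ring].
    + intros; apply Rmult_comm.
  - unfold plus, mult, one; simpl. field. nra.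
Qed.

Lemma flux_slope_lt (x y : R) : x < y -> flux_slope x < flux_slope y.
Proof.
  intros hxy. eapply derive_pos_lt; [exact hxy | | |].
  - intros z _. apply is_derive_flux_slope.
  - intros z _. apply Rdiv_lt_0_compat; [apply Rmult_lt_0_compat; [apply Rpower_pos |] |]; nra.
  - intros z _. eapply is_derive_continuous, is_derive_flux_slope.
Qed.

Lemma weight_eq (w : R -> R) (x : R) : 0 < w x ->
  weight p be w x = Rpower (be * w x) (p - 2) * Rpower (1 + slope w x ^ 2) (p / 2 - 1).
Proof.
  intros hw. assert (hbw : 0 < be * w x) by nra.
  unfold weight.
  replace (be ^ 2 * w x ^ 2 + Derive w x ^ 2) with ((be * w x) ^ 2 * (1 + slope w x ^ 2))
    by (unfold slope; field; lra).
  rewrite <- Rpower_mult_distr by nra. f_equal.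
  rewrite <- (Rpower_pow 2) by exact hbw. rewrite Rpower_mult. f_equal. simpl. field.
Qed.

Lemma flux_eq (w : R -> R) (x : R) : 0 < w x ->
  flux p be w x = Rpower (be * w x) (p - 1) * flux_slope (slope w x).
Proof.
  intros hw. assert (hbw : 0 < be * w x) by nra.
  unfold flux. rewrite weight_eq by exact hw. unfold flux_slope.
  replace (Derive w x) with (be * w x * slope w x) by (unfold slope; field; lra).
  rewrite (Rpower_pred (be * w x) (p - 1)) by exact hbw.
  replace (p - 1 - 1) with (p - 2) by ring. ring.
Qed.

Lemma cos_sq_atan (t : R) : cos_sq (atan t) = / (1 + t ^ 2).
Proof.
  assert (ht : 0 < 1 + t²) by (unfold Rsqr; nra).
  unfold cos_sq. rewrite cos_atan.
  unfold Rdiv. rewrite Rmult_1_l, pow_inv. f_equal.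
  rewrite <- Rsqr_pow2, Rsqr_sqrt by lra. unfold Rsqr. ring.
Qed.

Definition angle (w : R -> R) (x : R) : R := atan (slope w x).

(** One computation for both equations: [v] will be [excess w x] for the equation of [w], and [0]
    for the spherical one. Multiplying the flux by [(be w)^(1-p)] gives the derivative of
    [flux_slope (slope w)]; [flux_slope] is strictly increasing with nonzero derivative, so
    [slope w] is differentiable too. *)
Lemma is_derive_slope (w : R -> R) (a b v : R) :
  (forall y, a < y < b -> 0 < w y) -> flux_regular p be a b w ->
  forall x, a < x < b ->
  - Derive (flux p be w) x =
    Rpower (be * w x) (p - 1) * Rpower (1 + slope w x ^ 2) (p / 2) * v
    + be * (be * (p - 1) + p - 2) * weight p be w x * w x ->
  is_derive (slope w) x ((1 + slope w x ^ 2) * (1 - (kap + v) / inertia (cos_sq (angle w x)))).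
Proof.
  intros hw hreg x hx heq.
  destruct (hreg x hx) as [hdw hdf].
  assert (hwx : 0 < w x) by now apply hw.
  assert (hbw : 0 < be * w x) by nra.
  set (t := slope w x) in *.
  assert (ht : 0 < 1 + t ^ 2) by nra.
  assert (hwd : Derive w x = be * w x * t) by (unfold t, slope; field; lra).
  assert (hloc : locally x (fun y => a < y < b)) by now apply locally_lt_gt.
  assert (hgt : is_derive (fun y => flux_slope (slope w y)) x
    (- (Rpower (1 + t ^ 2) (p / 2 - 1) * ((1 + t ^ 2) * v + be * (p - 1) * (1 + t ^ 2) + p - 2)))).
  { apply (is_derive_ext_loc (fun y => flux p be w y * Rpower (be * w y) (1 - p))).
    - generalize hloc. apply filter_imp. intros y hy.
      pose proof (hw y hy) as hwy. assert (hbwy : 0 < be * w y) by nra.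
      rewrite flux_eq by exact hwy.
      replace (1 - p) with (- (p - 1)) by ring. rewrite Rpower_Ropp.
      pose proof (Rpower_pos (be * w y) (p - 1)).
      change (Rpower (be * w y) (p - 1) * flux_slope (slope w y) * / Rpower (be * w y) (p - 1) = flux_slope (slope w y)).
      field. lra.
    - evar_last.
      + apply (is_derive_mult (flux p be w) (fun y => Rpower (be * w y) (1 - p))).
        * apply Derive_correct, hdf.
        * apply is_derive_Rpower; [exact hbw |].
          apply (is_derive_scal w), Derive_correct, hdw.
        * intros; apply Rmult_comm.
      + unfold plus, mult; cbn -[pow].
        replace (Derive (flux p be w) x) with (- - Derive (flux p be w) x) by ring.
        rewrite heq, flux_eq, weight_eq, hwd by exact hwx. fold t. unfold flux_slope.
        rewrite (Rpower_pred (1 + t ^ 2) (p / 2)) by exact ht.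
        rewrite (Rpower_pred (be * w x) (p - 1)) by exact hbw.
        replace (p - 1 - 1) with (p - 2) by ring.
        replace (Rpower (be * w x) (1 - p)) with (/ Rpower (be * w x) (p - 2) / (be * w x)).
        * pose proof (Rpower_pos (be * w x) (p - 2)). field. repeat split; lra.
        * replace (1 - p) with (- (p - 1)) by ring.
          rewrite Rpower_Ropp, (Rpower_pred (be * w x) (p - 1)) by exact hbw.
          replace (p - 1 - 1) with (p - 2) by ring.
          pose proof (Rpower_pos (be * w x) (p - 2)). field. repeat split; lra. }
  assert (hct : continuous (slope w) x).
  { apply (inverse_continuous (fun _ => True) flux_slope).
    - intros u u' _ _. apply flux_slope_lt.
    - now apply filter_forall.
    - now apply filter_forall.
    - eapply is_derive_continuous, hgt. }
  pose proof (Rpower_pos (1 + t ^ 2) (p / 2 - 1)) as hU.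
  evar_last.
  - eapply (inverse_derive flux_slope (slope w) x); [exact hct | apply is_derive_flux_slope | | exact hgt].
    fold t. apply Rgt_not_eq, Rdiv_lt_0_compat; [apply Rmult_lt_0_compat; [exact hU | nra] | exact ht].
  - unfold angle. fold t. rewrite cos_sq_atan. unfold inertia, kap.
    assert (0 < 1 + (p - 1) * t ^ 2) by nra.
    field. repeat split; nra.
Qed.

Lemma is_derive_angle (w : R -> R) (x d : R) :
  is_derive (slope w) x ((1 + slope w x ^ 2) * d) -> is_derive (angle w) x d.
Proof.
  intros hd. unfold angle. evar_last.
  - apply (is_derive_comp atan (slope w)); [apply is_derive_atan | exact hd].
  - unfold scal; simpl; unfold mult, Rsqr; simpl. field. nra.
Qed.

Lemma angle_bound (w : R -> R) (x : R) : - (PI / 2) < angle w x < PI / 2.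
Proof. unfold angle. pose proof (atan_bound (slope w x)). lra. Qed.

Lemma is_derive_ln_positive (w : R -> R) (x : R) : 0 < w x -> ex_derive w x ->
  is_derive (fun y => ln (w y)) x (be * slope w x).
Proof.
  intros hw hd. evar_last.
  - apply (is_derive_comp ln w); [apply is_derive_ln, hw | apply Derive_correct, hd].
  - unfold scal; simpl; unfold mult, slope; simpl. field. lra.
Qed.

(** The derivative of [ln w] is [be * slope w]. Were it bounded above near [a], then [ln w] would
    stay bounded below there, against [w] tending to [0]. *)
Lemma slope_unbounded_left (w : R -> R) (a b : R) :
  (forall y, a < y < b -> 0 < w y) -> (forall y, a < y < b -> ex_derive w y) ->
  filterlim w (at_right a) (locally 0) ->
  forall x0 M, a < x0 < b -> exists x, a < x < x0 /\ M < slope w x.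
Proof.
  intros hw hd hlim x0 M hx0. apply NNPP. intros hn.
  assert (hM : forall x, a < x < x0 -> slope w x <= M).
  { intros x hx. apply Rnot_lt_le. intros h. apply hn. now exists x. }
  set (x1 := (a + x0) / 2).
  (* The lower bound for [w] on [(a, x1)] that [slope w <= M] would imply. *)
  set (c := exp (ln (w x1) - be * Rabs M * (x1 - a))).
  assert (hc : 0 < c) by apply exp_pos.
  assert (hev : at_right a (fun x => w x < c)).
  { apply (hlim (fun z => z < c)). generalize (locally_lt_gt 0 (-1) c ltac:(lra)).
    apply filter_imp. tauto. }
  destruct (locally_elim _ _ hev) as [e [he0 he]].
  set (x := a + Rmin (e / 2) ((x1 - a) / 2)).
  assert (hm : 0 < Rmin (e / 2) ((x1 - a) / 2)) by (apply Rmin_pos; unfold x1; lra).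
  pose proof (Rmin_l (e / 2) ((x1 - a) / 2)) as hl. pose proof (Rmin_r (e / 2) ((x1 - a) / 2)) as hr.
  assert (hx : a < x < x1) by (unfold x, x1 in *; lra).
  assert (hxe : x - a < e) by (unfold x; lra).
  assert (hx1 : x1 < x0) by (unfold x1; lra).
  assert (hwx : w x < c).
  { apply he; [| lra]. rewrite Rabs_pos_eq; lra. }
  assert (hmono : be * Rabs M * x - ln (w x) <= be * Rabs M * x1 - ln (w x1)).
  { apply (derive_nonneg_le (fun y => be * Rabs M * y - ln (w y))
      (fun y => be * Rabs M - be * slope w y)); [lra | |].
    - intros z hz. apply (is_derive_minus (fun y => be * Rabs M * y) (fun y => ln (w y))).
      + auto_derive; [exact I | ring].
      + apply is_derive_ln_positive; [apply hw | apply hd]; lra.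
    - intros z hz. pose proof (hM z ltac:(lra)). pose proof (Rle_abs M).
      assert (0 <= be * (Rabs M - slope w z)) by (apply Rmult_le_pos; lra). lra. }
  apply ln_increasing in hwx; [| apply hw; lra].
  unfold c in hwx. rewrite ln_exp in hwx.
  assert (0 <= be * Rabs M * (x - a)).
  { apply Rmult_le_pos; [apply Rmult_le_pos; [lra | apply Rabs_pos] | lra]. }
  lra.
Qed.

Lemma slope_unbounded_right (w : R -> R) (a b : R) :
  (forall y, a < y < b -> 0 < w y) -> (forall y, a < y < b -> ex_derive w y) ->
  filterlim w (at_left b) (locally 0) ->
  forall x0 M, a < x0 < b -> exists x, x0 < x < b /\ slope w x < M.
Proof.
  intros hw hd hlim x0 M hx0. apply NNPP. intros hn.
  assert (hM : forall x, x0 < x < b -> M <= slope w x).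
  { intros x hx. apply Rnot_lt_le. intros h. apply hn. now exists x. }
  set (x1 := (b + x0) / 2).
  set (c := exp (ln (w x1) - be * Rabs M * (b - x1))).
  assert (hc : 0 < c) by apply exp_pos.
  assert (hev : at_left b (fun x => w x < c)).
  { apply (hlim (fun z => z < c)). generalize (locally_lt_gt 0 (-1) c ltac:(lra)).
    apply filter_imp. tauto. }
  destruct (locally_elim _ _ hev) as [e [he0 he]].
  set (x := b - Rmin (e / 2) ((b - x1) / 2)).
  assert (hm : 0 < Rmin (e / 2) ((b - x1) / 2)) by (apply Rmin_pos; unfold x1; lra).
  pose proof (Rmin_l (e / 2) ((b - x1) / 2)) as hl. pose proof (Rmin_r (e / 2) ((b - x1) / 2)) as hr.
  assert (hx : x1 < x < b) by (unfold x, x1 in *; lra).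
  assert (hxe : b - x < e) by (unfold x; lra).
  assert (hx1 : x0 < x1) by (unfold x1; lra).
  assert (hwx : w x < c).
  { apply he; [| lra]. rewrite Rabs_left1; lra. }
  assert (hmono : be * Rabs M * x1 + ln (w x1) <= be * Rabs M * x + ln (w x)).
  { apply (derive_nonneg_le (fun y => be * Rabs M * y + ln (w y))
      (fun y => be * Rabs M + be * slope w y)); [lra | |].
    - intros z hz. apply (is_derive_plus (fun y => be * Rabs M * y) (fun y => ln (w y))).
      + auto_derive; [exact I | ring].
      + apply is_derive_ln_positive; [apply hw | apply hd]; lra.
    - intros z hz. pose proof (hM z ltac:(lra)). pose proof (Rle_abs (- M)) as hab.
      rewrite Rabs_Ropp in hab.
      assert (0 <= be * (Rabs M + slope w z)) by (apply Rmult_le_pos; lra). lra. }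
  apply ln_increasing in hwx; [| apply hw; lra].
  unfold c in hwx. rewrite ln_exp in hwx.
  assert (0 <= be * Rabs M * (b - x)).
  { apply Rmult_le_pos; [apply Rmult_le_pos; [lra | apply Rabs_pos] | lra]. }
  lra.
Qed.

(** * The excess [V] and the conserved energy *)

Definition lam : R := be * (be * (p - 1) + p - 2).

(** The quantity [V], with [q + 1 - p] written as [p / be]: only [p] and [be] occur until
    [source_equation] identifies the resulting source term with the power of [w]. *)
Definition excess (w : R -> R) (x : R) : R :=
  Rpower be (1 - p) * Rpower (w x) (p / be) * Rpower (1 + slope w x ^ 2) (- (p / 2)).

Definition source_solution (a b : R) (w : R -> R) : Prop :=
  positive_vanishing a b w /\ flux_regular p be a b w /\
  forall x, a < x < b ->
    - Derive (flux p be w) x =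
    Rpower (be * w x) (p - 1) * Rpower (1 + slope w x ^ 2) (p / 2) * excess w x
    + lam * weight p be w x * w x.

Lemma excess_pos (w : R -> R) (x : R) : 0 < excess w x.
Proof. unfold excess. repeat apply Rmult_lt_0_compat; apply Rpower_pos. Qed.

Lemma is_derive_excess (w : R -> R) (x d : R) : 0 < w x -> ex_derive w x ->
  is_derive (slope w) x ((1 + slope w x ^ 2) * d) ->
  is_derive (excess w) x (excess w x * (p * slope w x * (1 - d))).
Proof.
  intros hw hdw hdt. set (t := slope w x) in *. assert (ht : 0 < 1 + t ^ 2) by nra.
  unfold excess. evar_last.
  - apply (is_derive_mult (fun x => Rpower be (1 - p) * Rpower (w x) (p / be))
      (fun x => Rpower (1 + slope w x ^ 2) (- (p / 2)))).
    + apply (is_derive_scal (fun x => Rpower (w x) (p / be))).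
      apply is_derive_Rpower; [exact hw | apply Derive_correct, hdw].
    + apply (is_derive_Rpower (fun x => 1 + slope w x ^ 2) x (2 * t * ((1 + t ^ 2) * d))); [exact ht |].
      evar_last.
      * apply (is_derive_comp (fun z => 1 + z ^ 2) (slope w) x (2 * t)); [| exact hdt].
        fold t. auto_derive; [exact I | ring].
      * unfold scal; cbn -[pow]; unfold mult; cbn -[pow]. ring.
    + intros; apply Rmult_comm.
  - fold t. replace (Derive w x) with (be * w x * t) by (unfold t, slope; field; lra).
    unfold plus, mult; cbn -[pow]. field. repeat split; nra.
Qed.

Definition excess_root (w : R -> R) (x : R) : R := Rpower (excess w x) (/ gamma_exp).

Lemma total_excess_root (w : R -> R) (x : R) : total (excess_root w x) = kap + excess w x.
Proof.
  unfold total, excess_root. rewrite pospow_inv; [reflexivity | apply gamma_exp_pos | apply excess_pos].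
Qed.

(** The constant of integration of the linear equation for [1/s = 1 + slope^2]: [lead] is the
    integrating factor and [Phi] compensates the inhomogeneous term. *)
Definition energy (w : R -> R) (x : R) : R :=
  (1 + slope w x ^ 2) * lead (excess_root w x) + Phi (excess_root w x).

Lemma first_int_energy (w : R -> R) (x : R) :
  first_int (cos_sq (angle w x)) (excess_root w x) = cos_sq (angle w x) * energy w x.
Proof.
  unfold first_int, energy, angle. rewrite cos_sq_atan. field. nra.
Qed.

Lemma is_derive_energy (w : R -> R) (x : R) : 0 < w x -> ex_derive w x ->
  is_derive (slope w) x ((1 + slope w x ^ 2) * (1 - (kap + excess w x) / inertia (cos_sq (angle w x)))) ->
  is_derive (energy w) x 0.
Proof.
  intros hw hdw hdt.
  pose proof (is_derive_excess w x _ hw hdw hdt) as hdv.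
  pose proof (excess_pos w x) as hv. pose proof gamma_exp_pos as hg.
  assert (hr : 0 < excess_root w x) by apply Rpower_pos.
  assert (hdr := is_derive_Rpower (excess w) x _ (/ gamma_exp) hv hdv). fold (excess_root w) in hdr.
  change (Rpower (excess w x) (/ gamma_exp)) with (excess_root w x) in hdr.
  assert (hm : 0 < inertia (cos_sq (angle w x))) by apply inertia_pos, cos_sq_bound.
  pose proof (total_excess_root w x) as hX. pose proof (total_pos (excess_root w x)) as hXp.
  unfold energy. evar_last.
  - apply (is_derive_plus (fun x => (1 + slope w x ^ 2) * lead (excess_root w x)) (fun x => Phi (excess_root w x))).
    + apply (is_derive_mult (fun x => 1 + slope w x ^ 2) (fun x => lead (excess_root w x))).
      * apply (is_derive_comp (fun z => 1 + z ^ 2) (slope w) x (2 * slope w x)); [| exact hdt].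
        auto_derive; [exact I | ring].
      * apply (is_derive_comp lead (excess_root w)); [now apply is_derive_lead | exact hdr].
      * intros; apply Rmult_comm.
    + apply (is_derive_comp Phi (excess_root w)); [apply is_derive_Phi | exact hdr].
  - unfold plus, scal; cbn -[pow]; unfold mult; cbn -[pow].
    assert (hms : (1 + slope w x ^ 2) * inertia (cos_sq (angle w x)) = 1 + (p - 1) * slope w x ^ 2).
    { unfold angle. rewrite cos_sq_atan. unfold inertia. field. nra. }
    unfold dlead, lead. rewrite (Rpower_pred (total (excess_root w x)) lead_exp) by exact hXp.
    generalize (Rpower (total (excess_root w x)) (lead_exp - 1)). intros E.
    rewrite hX. revert hms hm. generalize (inertia (cos_sq (angle w x))). intros m hms hm.
    set (t := slope w x) in *. assert (ht : 0 < 1 + t ^ 2) by nra.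
    assert (hmt : m = (1 + (p - 1) * t ^ 2) / (1 + t ^ 2)) by (rewrite <- hms; field; lra).
    rewrite hmt. unfold gamma_exp, kap. field. repeat split; nra.
Qed.

Lemma derive_zero_eq (f : R -> R) (a b x y : R) :
  (forall z, a < z < b -> is_derive f z 0) -> a < x < b -> a < y < b -> f x = f y.
Proof.
  intros hd. enough (H : forall x y, a < x < b -> a < y < b -> x <= y -> f x = f y).
  { intros hx hy. destruct (Rle_lt_dec x y) as [h|h]; [| symmetry]; apply H; lra. }
  intros u v hu hv huv. apply Rle_antisym.
  - apply (derive_nonneg_le f (fun _ => 0)); [exact huv | intros z hz; apply hd; lra | intros; lra].
  - apply Ropp_le_cancel.
    apply (derive_nonneg_le (fun z => - f z) (fun _ => - 0)); [exact huv | | intros; lra].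
    intros z hz. apply (is_derive_opp f), hd. lra.
Qed.

(** The level is the constant energy. It is positive because near [a] the slope becomes so large
    that [m <= K], where [first_int] is positive. Positivity then excludes [X <= m] along the whole
    arc, which places [excess_root w] on the branch [rho]. *)
Lemma source_trajectory (a b : R) (w : R -> R) : a < b -> source_solution a b w ->
  exists h, 0 < h /\ forall x, a < x < b ->
    is_derive (angle w) x (- / time_density (angle w x) h) /\
    excess_root w x = rho_at (angle w x) h.
Proof.
  intros hab [[hpos [hla hlb]] [hreg heq]].
  assert (hdw : forall x, a < x < b -> ex_derive w x) by (intros x hx; now apply hreg).
  assert (hdt : forall x, a < x < b -> is_derive (slope w) x
     ((1 + slope w x ^ 2) * (1 - (kap + excess w x) / inertia (cos_sq (angle w x))))).
  { intros x hx. apply (is_derive_slope w a b); [exact hpos | exact hreg | exact hx | now apply heq]. }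
  set (h := energy w ((a + b) / 2)).
  assert (hE : forall x, a < x < b -> energy w x = h).
  { intros x hx. apply (derive_zero_eq _ a b); [| exact hx | lra].
    intros z hz. apply is_derive_energy; [now apply hpos | now apply hdw | now apply hdt]. }
  assert (hvr : forall x, 0 < excess_root w x) by (intros; apply Rpower_pos).
  assert (hK := kap_gt).
  assert (hh : 0 < h).
  { assert (hpb : 0 < (p - 1) * be) by nra.
    (* A slope above this value gives [s <= (p-1) be], hence [m = p-1 + (2-p) s <= K] because
       [2 - p < 1]. *)
    destruct (slope_unbounded_left w a b hpos hdw hla ((a + b) / 2) (/ ((p - 1) * be)) ltac:(lra))
      as [x [hx hxt]].
    assert (hs : cos_sq (angle w x) <= (p - 1) * be).
    { unfold angle. rewrite cos_sq_atan. rewrite <- (Rinv_inv ((p - 1) * be)).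
      pose proof (Rinv_0_lt_compat _ hpb). apply Rinv_le_contravar; nra. }
    pose proof (cos_sq_bound (angle w x)).
    assert (hP : 0 < first_int (cos_sq (angle w x)) (excess_root w x)).
    { apply first_int_pos; [apply hvr | unfold inertia, kap; nra]. }
    rewrite first_int_energy, hE in hP by lra. nra. }
  exists h. split; [exact hh |]. intros x hx.
  assert (hs : 0 < cos_sq (angle w x)).
  { unfold angle. rewrite cos_sq_atan. apply Rinv_0_lt_compat. nra. }
  assert (hmX : inertia (cos_sq (angle w x)) < total (excess_root w x)).
  { apply Rnot_le_lt. intros hn. pose proof (first_int_neg _ _ (hvr x) hn) as hP.
    rewrite first_int_energy, hE in hP by exact hx. nra. }
  assert (hrr : excess_root w x = rho_at (angle w x) h).
  { apply rho_unique; [exact hh | apply cos_sq_bound | apply Rlt_le, hvr | | exact hmX].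
    now rewrite first_int_energy, hE. }
  split; [| exact hrr].
  pose proof (inertia_pos _ (cos_sq_bound (angle w x))).
  evar_last; [apply is_derive_angle, hdt, hx |].
  unfold time_density. rewrite <- hrr, <- total_excess_root. field. lra.
Qed.

(** * The clock and the comparison of trajectories; uniqueness *)

Lemma nonincreasing_ends (Q : R -> R) (a b A B : R) :
  (forall x y, a < x -> x <= y -> y < b -> Q y <= Q x) ->
  (forall x0 eps, a < x0 < b -> 0 < eps -> exists y, a < y < x0 /\ Rabs (Q y - A) < eps) ->
  (forall x0 eps, a < x0 < b -> 0 < eps -> exists y, x0 < y < b /\ Rabs (Q y - B) < eps) ->
  forall x, a < x < b -> B <= Q x <= A.
Proof.
  intros hQ hA hB x hx. split; apply Rnot_lt_le; intros hn.
  - destruct (hB x (B - Q x) hx ltac:(lra)) as [y [hy hQy]].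
    apply Rabs_lt_between in hQy. pose proof (hQ x y ltac:(lra) ltac:(lra) ltac:(lra)). lra.
  - destruct (hA x (Q x - A) hx ltac:(lra)) as [y [hy hQy]].
    apply Rabs_lt_between in hQy. pose proof (hQ y x ltac:(lra) ltac:(lra) ltac:(lra)). lra.
Qed.

Lemma atan_gt_near (d : R) : 0 < d -> exists M, forall t, M < t -> PI / 2 - d < atan t < PI / 2.
Proof.
  intros hd. pose proof PI_RGT_0.
  set (e := Rmin d 1). assert (he : 0 < e) by (apply Rmin_pos; lra).
  assert (he1 : e <= d) by apply Rmin_l. assert (he2 : e <= 1) by apply Rmin_r.
  pose proof PI2_1.
  exists (tan (PI / 2 - e)). intros t ht. apply atan_increasing in ht.
  rewrite atan_tan in ht by lra. pose proof (atan_bound t). lra.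
Qed.

Lemma Theta_ends_left (T : R -> R) (h a b : R) : 0 < h ->
  (forall x0 M, a < x0 < b -> exists x, a < x < x0 /\ M < T x) ->
  forall x0 eps, a < x0 < b -> 0 < eps ->
  exists y, a < y < x0 /\ Rabs (Theta h (atan (T y)) + y - (Theta h (PI / 2) + a)) < eps.
Proof.
  intros hh hu x0 eps hx0 heps.
  destruct (locally_elim _ _ (continuous_locally _ (PI / 2) (eps / 2) ltac:(lra)
    (continuous_Theta h (PI / 2) hh))) as [d [hd0 hd]].
  destruct (atan_gt_near d hd0) as [M hM].
  assert (hm : a < Rmin x0 (a + eps / 2)) by (apply Rmin_glb_lt; lra).
  pose proof (Rmin_l x0 (a + eps / 2)). pose proof (Rmin_r x0 (a + eps / 2)).
  destruct (hu (Rmin x0 (a + eps / 2)) M ltac:(lra)) as [y [hy hyM]].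
  exists y. split; [lra |].
  specialize (hM _ hyM). specialize (hd (atan (T y))).
  assert (hT : Theta h (PI / 2) - eps / 2 < Theta h (atan (T y)) < Theta h (PI / 2) + eps / 2).
  { apply hd. rewrite Rabs_left; lra. }
  apply Rabs_lt_between. lra.
Qed.

Lemma Theta_ends_right (T : R -> R) (h a b : R) : 0 < h ->
  (forall x0 M, a < x0 < b -> exists x, x0 < x < b /\ T x < M) ->
  forall x0 eps, a < x0 < b -> 0 < eps ->
  exists y, x0 < y < b /\ Rabs (Theta h (atan (T y)) + y - b) < eps.
Proof.
  intros hh hu x0 eps hx0 heps.
  destruct (locally_elim _ _ (continuous_locally _ (- (PI / 2)) (eps / 2) ltac:(lra)
    (continuous_Theta h (- (PI / 2)) hh))) as [d [hd0 hd]].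
  destruct (atan_gt_near d hd0) as [M hM].
  assert (hm : Rmax x0 (b - eps / 2) < b) by (apply Rmax_lub_lt; lra).
  pose proof (Rmax_l x0 (b - eps / 2)). pose proof (Rmax_r x0 (b - eps / 2)).
  destruct (hu (Rmax x0 (b - eps / 2)) (- M) ltac:(lra)) as [y [hy hyM]].
  exists y. split; [lra |].
  specialize (hM (- T y) ltac:(lra)). rewrite atan_opp in hM. specialize (hd (atan (T y))).
  assert (hT : Theta h (- (PI / 2)) - eps / 2 < Theta h (atan (T y)) < Theta h (- (PI / 2)) + eps / 2).
  { apply hd. rewrite Rabs_pos_eq; lra. }
  rewrite Theta_start in hT.
  apply Rabs_lt_between. lra.
Qed.

Lemma is_derive_clock (al : R -> R) (h x d : R) : 0 < h -> is_derive al x d ->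
  is_derive (fun y => Theta h (al y) + y) x (d * time_density (al x) h + 1).
Proof.
  intros hh hd.
  apply (is_derive_plus (fun y => Theta h (al y)) (fun y => y)).
  - apply (is_derive_comp (Theta h) al); [now apply is_derive_Theta | exact hd].
  - apply (is_derive_id (K := R_AbsRing)).
Qed.

(** The slope [T] may come from another equation or another level than [h]. As [T] takes arbitrarily
    large values near [a] and arbitrarily negative ones near [b], the clock comes arbitrarily close
    to [Theta h (PI/2) + a] and to [b] there, which suffices for a monotone function. In particular
    [b - a <= Theta h (PI/2)]. *)
Lemma clock_ends (a b h : R) (T d : R -> R) : 0 < h ->
  (forall x0 M, a < x0 < b -> exists x, a < x < x0 /\ M < T x) ->
  (forall x0 M, a < x0 < b -> exists x, x0 < x < b /\ T x < M) ->
  (forall x, a < x < b -> is_derive (fun y => atan (T y)) x (d x)) ->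
  (forall x, a < x < b -> d x * time_density (atan (T x)) h + 1 <= 0) ->
  forall x, a < x < b -> b <= Theta h (atan (T x)) + x <= Theta h (PI / 2) + a.
Proof.
  intros hh huL huR hd hle.
  apply nonincreasing_ends.
  - intros x y hx hxy hy. apply Ropp_le_cancel.
    apply (derive_nonneg_le (fun y => - (Theta h (atan (T y)) + y))
      (fun y => - (d y * time_density (atan (T y)) h + 1))); [exact hxy | |].
    + intros z hz. apply (is_derive_opp (fun y => Theta h (atan (T y)) + y)).
      apply (is_derive_clock (fun y => atan (T y))); [exact hh | apply hd; lra].
    + intros z hz. pose proof (hle z ltac:(lra)). lra.
  - now apply Theta_ends_left.
  - now apply Theta_ends_right.
Qed.

Lemma clock_ends_rev (a b h : R) (T d : R -> R) : 0 < h ->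
  (forall x0 M, a < x0 < b -> exists x, a < x < x0 /\ M < T x) ->
  (forall x0 M, a < x0 < b -> exists x, x0 < x < b /\ T x < M) ->
  (forall x, a < x < b -> is_derive (fun y => atan (T y)) x (d x)) ->
  (forall x, a < x < b -> 0 <= d x * time_density (atan (T x)) h + 1) ->
  forall x, a < x < b -> Theta h (PI / 2) + a <= Theta h (atan (T x)) + x <= b.
Proof.
  intros hh huL huR hd hle x hx.
  enough (- b <= - (Theta h (atan (T x)) + x) <= - (Theta h (PI / 2) + a)) by lra.
  apply (nonincreasing_ends (fun x => - (Theta h (atan (T x)) + x)) a b); [| | | exact hx].
  - intros u v hu huv hv. apply Ropp_le_contravar.
    apply (derive_nonneg_le (fun y => Theta h (atan (T y)) + y)
      (fun y => d y * time_density (atan (T y)) h + 1)); [exact huv | |].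
    + intros z hz. apply (is_derive_clock (fun y => atan (T y))); [exact hh | apply hd; lra].
    + intros z hz. apply hle; lra.
  - intros x0 eps hx0 heps.
    destruct (Theta_ends_left T h a b hh huL x0 eps hx0 heps)
      as [y [hy hyQ]].
    exists y. split; [exact hy |]. rewrite <- Rabs_Ropp.
    replace (- (- (Theta h (atan (T y)) + y) - - (Theta h (PI / 2) + a)))
      with (Theta h (atan (T y)) + y - (Theta h (PI / 2) + a)) by ring. exact hyQ.
  - intros x0 eps hx0 heps.
    destruct (Theta_ends_right T h a b hh huR x0 eps hx0 heps)
      as [y [hy hyQ]].
    exists y. split; [exact hy |]. rewrite <- Rabs_Ropp.
    replace (- (- (Theta h (atan (T y)) + y) - - b))
      with (Theta h (atan (T y)) + y - b) by ring. exact hyQ.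
Qed.

(** At the level of [w] itself the clock has rate [0], so both comparisons apply. *)
Lemma source_solution_length (a b : R) (w : R -> R) (h : R) : a < b -> 0 < h ->
  source_solution a b w ->
  (forall x, a < x < b -> is_derive (angle w) x (- / time_density (angle w x) h)) ->
  Theta h (PI / 2) = b - a /\ forall x, a < x < b -> Theta h (angle w x) + x = b.
Proof.
  intros hab hh [[hpos [hla hlb]] [hreg heq]] hd.
  assert (hdw : forall x, a < x < b -> ex_derive w x) by (intros x hx; now apply hreg).
  assert (hz : forall x, - / time_density (angle w x) h * time_density (angle w x) h + 1 = 0).
  { intros x. pose proof (time_density_pos (angle w x) h hh). field. lra. }
  pose proof (slope_unbounded_left w a b hpos hdw hla) as huL.
  pose proof (slope_unbounded_right w a b hpos hdw hlb) as huR.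
  pose proof (clock_ends a b h (slope w) (fun x => - / time_density (angle w x) h) hh huL huR hd
    ltac:(intros x _; change (atan (slope w x)) with (angle w x); cbv beta; rewrite hz; lra)) as h1.
  pose proof (clock_ends_rev a b h (slope w) (fun x => - / time_density (angle w x) h) hh huL huR hd
    ltac:(intros x _; change (atan (slope w x)) with (angle w x); cbv beta; rewrite hz; lra)) as h2.
  split.
  - specialize (h1 ((a + b) / 2) ltac:(lra)). specialize (h2 ((a + b) / 2) ltac:(lra)). lra.
  - intros x hx. specialize (h1 x hx). specialize (h2 x hx). unfold angle. lra.
Qed.

Lemma excess_inj (w1 w2 : R -> R) (x : R) : 0 < w1 x -> 0 < w2 x ->
  slope w1 x = slope w2 x -> excess w1 x = excess w2 x -> w1 x = w2 x.
Proof.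
  intros h1 h2 ht hv. unfold excess in hv. rewrite ht in hv.
  apply Rmult_eq_reg_r in hv; [| apply Rgt_not_eq, Rpower_pos].
  apply Rmult_eq_reg_l in hv; [| apply Rgt_not_eq, Rpower_pos].
  apply (f_equal ln) in hv. rewrite !ln_Rpower in hv.
  apply Rmult_eq_reg_l in hv; [now apply ln_inv |].
  apply Rgt_not_eq, Rdiv_lt_0_compat; lra.
Qed.

(** For [h1 <= h2] the clock of level [h1] is nonincreasing along [w2], while its two end bounds
    coincide because [w1] lives on the same arc. It is therefore constant and the angles agree.
    Equal angular speeds then give equal [X], and equal slope and excess determine [w]. *)
Lemma source_solution_unique (a b : R) (w1 w2 : R -> R) : a < b ->
  source_solution a b w1 -> source_solution a b w2 ->
  forall x, a < x < b -> w1 x = w2 x.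
Proof.
  intros hab hs1 hs2.
  destruct (source_trajectory a b w1 hab hs1) as [h1 [hh1 ht1]].
  destruct (source_trajectory a b w2 hab hs2) as [h2 [hh2 ht2]].
  revert w1 w2 h1 h2 hs1 hs2 hh1 hh2 ht1 ht2.
  enough (H : forall (w1 w2 : R -> R) h1 h2,
    source_solution a b w1 -> source_solution a b w2 -> 0 < h1 -> h1 <= h2 ->
    (forall x, a < x < b -> is_derive (angle w1) x (- / time_density (angle w1 x) h1) /\
       excess_root w1 x = rho_at (angle w1 x) h1) ->
    (forall x, a < x < b -> is_derive (angle w2) x (- / time_density (angle w2 x) h2) /\
       excess_root w2 x = rho_at (angle w2 x) h2) ->
    forall x, a < x < b -> w1 x = w2 x).
  { intros w1 w2 h1 h2 hs1 hs2 hh1 hh2 ht1 ht2 x hx.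
    destruct (Rle_lt_dec h1 h2) as [h|h].
    - now apply (H w1 w2 h1 h2).
    - symmetry. apply (H w2 w1 h2 h1); try assumption. lra. }
  intros w1 w2 h1 h2 hs1 hs2 hh1 h12 ht1 ht2.
  assert (hh2 : 0 < h2) by lra.
  destruct (source_solution_length a b w1 h1 hab hh1 hs1 (fun x hx => proj1 (ht1 x hx)))
    as [hL hQ1].
  assert (hQ2 : forall x, a < x < b -> Theta h1 (angle w2 x) + x = b).
  { intros x hx.
    enough (b <= Theta h1 (angle w2 x) + x <= Theta h1 (PI / 2) + a) by lra.
    destruct hs2 as [[hpos [hla hlb]] [hreg heq]].
    assert (hdw : forall y, a < y < b -> ex_derive w2 y) by (intros y hy; now apply hreg).
    apply (clock_ends a b h1 (slope w2) (fun x => - / time_density (angle w2 x) h2)); [exact hh1 | | | | | exact hx].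
    - now apply slope_unbounded_left.
    - now apply slope_unbounded_right.
    - intros y hy. now apply ht2.
    - intros y hy. change (atan (slope w2 y)) with (angle w2 y).
      pose proof (time_density_pos (angle w2 y) h2 hh2) as hg2.
      pose proof (time_density_decr (angle w2 y) h1 h2 hh1 h12) as hg.
      enough (1 <= time_density (angle w2 y) h1 / time_density (angle w2 y) h2) by (unfold Rdiv in *; lra).
      apply Rle_div_r; lra. }
  assert (hang : forall x, a < x < b -> angle w1 x = angle w2 x).
  { intros x hx. pose proof (hQ1 x hx). pose proof (hQ2 x hx).
    destruct (Rtotal_order (angle w1 x) (angle w2 x)) as [h|[h|h]]; [| exact h |];
      apply (Theta_lt h1) in h; lra. }
  intros x hx. pose proof (hang x hx) as hax.
  destruct (ht1 x hx) as [hd1 hr1], (ht2 x hx) as [hd2 hr2].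
  assert (hd1' : is_derive (angle w2) x (- / time_density (angle w1 x) h1)).
  { apply (is_derive_ext_loc (angle w1)); [| exact hd1].
    generalize (locally_lt_gt x a b hx). apply filter_imp. exact hang. }
  apply is_derive_unique in hd1'. apply is_derive_unique in hd2. rewrite hd1' in hd2.
  apply Ropp_eq_compat in hd2. rewrite !Ropp_involutive, hax in hd2.
  apply Rinv_eq_reg in hd2. unfold time_density in hd2.
  pose proof (inertia_pos _ (cos_sq_bound (angle w2 x))) as hm.
  pose proof (rho_at_spec (angle w2 x) h1 hh1) as [_ [_ hX1]].
  pose proof (rho_at_spec (angle w2 x) h2 hh2) as [_ [_ hX2]].
  apply Rmult_eq_reg_l in hd2; [| lra]. apply Rinv_eq_reg in hd2.
  assert (htt : slope w1 x = slope w2 x).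
  { unfold angle in hax. apply (f_equal tan) in hax. now rewrite !tan_atan in hax. }
  apply excess_inj; [now apply hs1 | now apply hs2 | exact htt |].
  pose proof (total_excess_root w1 x) as hv1. pose proof (total_excess_root w2 x) as hv2.
  rewrite hr1, hax in hv1. rewrite hr2 in hv2. lra.
Qed.

(** * Construction of a solution from a level with the right length *)

Lemma flux_derive_of_angle (w T : R -> R) (a b x v : R) : a < x < b ->
  (forall y, a < y < b -> 0 < w y) ->
  (forall y, a < y < b -> is_derive w y (be * T y * w y)) ->
  is_derive T x ((1 + T x ^ 2) * (1 - (kap + v) / inertia (/ (1 + T x ^ 2)))) ->
  is_derive (flux p be w) x
    (- (Rpower (be * w x) (p - 1) * Rpower (1 + slope w x ^ 2) (p / 2) * v
        + lam * weight p be w x * w x)).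
Proof.
  intros hx hpos hd hT.
  assert (hwx := hpos x hx). assert (hbw : 0 < be * w x) by nra.
  assert (htt : forall y, a < y < b -> slope w y = T y).
  { intros y hy. pose proof (hpos y hy). unfold slope.
    rewrite (is_derive_unique _ _ _ (hd y hy)). field. split; lra. }
  rewrite weight_eq, htt by assumption.
  set (t := T x) in *. assert (ht : 0 < 1 + t ^ 2) by nra.
  apply (is_derive_ext_loc (fun y => Rpower (be * w y) (p - 1) * flux_slope (T y))).
  { generalize (locally_lt_gt x a b hx). apply filter_imp. intros y hy.
    rewrite flux_eq by now apply hpos. now rewrite htt. }
  evar_last.
  - apply (is_derive_mult (fun y => Rpower (be * w y) (p - 1)) (fun y => flux_slope (T y))).
    + apply is_derive_Rpower; [exact hbw | apply (is_derive_scal w), hd, hx].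
    + apply (is_derive_comp flux_slope T); [apply is_derive_flux_slope | exact hT].
    + intros; apply Rmult_comm.
  - fold t. unfold plus, scal; cbn -[pow]; unfold mult; cbn -[pow]. unfold flux_slope.
    rewrite (Rpower_pred (1 + t ^ 2) (p / 2)) by exact ht.
    rewrite (Rpower_pred (be * w x) (p - 1)) by exact hbw.
    replace (p - 1 - 1) with (p - 2) by ring.
    assert (hm : inertia (/ (1 + t ^ 2)) = (1 + (p - 1) * t ^ 2) / (1 + t ^ 2)).
    { unfold inertia. field. lra. }
    rewrite hm. unfold lam, kap. field. repeat split; nra.
Qed.

Lemma is_derive_cos_sq (al : R) : is_derive cos_sq al (- 2 * tan al * cos_sq al) \/ cos al = 0.
Proof.
  destruct (Req_dec (cos al) 0) as [h|h]; [now right | left].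
  unfold cos_sq. auto_derive; [exact I |]. unfold tan. field. exact h.
Qed.

(** Solving the definition of [V] for [w] gives [rho^((1+be)/2) s^(-be/2)] up to a constant, which
    is indeterminate at [al = PI/2] and [-PI/2], where [rho] and [s] both vanish. Expressing
    [rho / s] by the first integral leaves a factor continuous and positive there, times [sqrt rho],
    so that the limit [0] can be read off. *)
Definition profile (al h : R) : R :=
  Rpower be ((p - 1) * be / p) *
  Rpower ((h - Phi (rho_at al h)) / Rpower (total (rho_at al h)) lead_exp) (be / 2) * sqrt (rho_at al h).

Lemma cos_sq_pos (al : R) : - (PI / 2) < al < PI / 2 -> 0 < cos_sq al.
Proof.
  intros hal. unfold cos_sq. pose proof (cos_gt_0 al ltac:(lra) ltac:(lra)). nra.
Qed.

Lemma rho_at_pos (al h : R) : 0 < h -> - (PI / 2) < al < PI / 2 -> 0 < rho_at al h.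
Proof.
  intros hh hal. apply rho_pos; [exact hh |].
  pose proof (cos_sq_pos al hal). pose proof (cos_sq_bound al). lra.
Qed.

Lemma conserved (al h : R) : 0 < h -> - (PI / 2) < al < PI / 2 ->
  h - Phi (rho_at al h) = lead (rho_at al h) / cos_sq al.
Proof.
  intros hh hal. pose proof (rho_at_spec al h hh) as [_ [hP _]]. pose proof (cos_sq_pos al hal).
  unfold first_int in hP.
  replace (lead (rho_at al h)) with (cos_sq al * h - cos_sq al * Phi (rho_at al h)) by lra. field. lra.
Qed.

Lemma profile_eq (al h : R) : 0 < h -> - (PI / 2) < al < PI / 2 ->
  profile al h = Rpower be ((p - 1) * be / p) * Rpower (rho_at al h) ((1 + be) / 2)
                 * Rpower (cos_sq al) (- (be / 2)).
Proof.
  intros hh hal. pose proof (rho_at_pos al h hh hal) as hr. pose proof (cos_sq_pos al hal) as hs.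
  unfold profile. rewrite conserved by assumption. unfold lead.
  pose proof (Rpower_pos (total (rho_at al h)) lead_exp) as hX.
  replace (rho_at al h * Rpower (total (rho_at al h)) lead_exp / cos_sq al / Rpower (total (rho_at al h)) lead_exp)
    with (rho_at al h * / cos_sq al) by (field; lra).
  pose proof (Rinv_0_lt_compat _ hs).
  rewrite <- Rpower_sqrt, <- Rpower_mult_distr by assumption.
  rewrite Rpower_Ropp.
  replace (Rpower (/ cos_sq al) (be / 2)) with (/ Rpower (cos_sq al) (be / 2)).
  - replace ((1 + be) / 2) with (be / 2 + / 2) by field. rewrite Rpower_plus. ring.
  - unfold Rpower. rewrite ln_Rinv by exact hs. rewrite <- exp_Ropp. f_equal. ring.
Qed.

Lemma profile_pos (al h : R) : 0 < h -> - (PI / 2) < al < PI / 2 -> 0 < profile al h.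
Proof.
  intros hh hal. rewrite profile_eq by assumption.
  repeat apply Rmult_lt_0_compat; apply Rpower_pos.
Qed.

Lemma profile_end (al h : R) : 0 < h -> cos al = 0 ->
  filterlim (fun u => profile u h) (locally al) (locally 0).
Proof.
  intros hh hc.
  assert (hr0 : rho_at al h = 0).
  { unfold rho_at, cos_sq. rewrite hc. replace (0 ^ 2) with 0 by ring. now apply rho_0. }
  assert (hcr := continuous_rho_at al h hh).
  assert (hp0 : profile al h = 0).
  { unfold profile. rewrite hr0, sqrt_0. ring. }
  rewrite <- hp0.
  apply (continuous_mult (K := R_AbsRing)
    (fun u => Rpower be ((p - 1) * be / p) *
       Rpower ((h - Phi (rho_at u h)) / Rpower (total (rho_at u h)) lead_exp) (be / 2)) (fun u => sqrt (rho_at u h))).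
  - apply (continuous_mult (K := R_AbsRing) (fun _ => Rpower be ((p - 1) * be / p))).
    + apply continuous_const.
    + apply continuous_Rpower.
      * rewrite hr0, Phi_0. apply Rdiv_lt_0_compat; [lra | apply Rpower_pos].
      * apply (continuous_mult (K := R_AbsRing) (fun u => h - Phi (rho_at u h))
          (fun u => / Rpower (total (rho_at u h)) lead_exp)).
        -- apply (continuous_minus (V := R_NormedModule) (fun _ => h) (fun u => Phi (rho_at u h))).
           ++ apply continuous_const.
           ++ apply (continuous_comp (fun u => rho_at u h) Phi); [exact hcr | apply continuous_Phi].
        -- apply (continuous_comp (fun u => rho_at u h) (fun r => / Rpower (total r) lead_exp)); [exact hcr |].
           apply (continuous_ext (fun r => Rpower (total r) (- lead_exp))).
           ++ intros r. apply Rpower_Ropp.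
           ++ apply continuous_powXX.
  - apply continuous_sqrt_comp, hcr.
Qed.

(** On a level, [s = lead r / (h - Phi r)] by [conserved]. The derivative of the right side in [r]
    is [dfirst_int s r * s / lead r], positive because [X > m], so [inverse_derive] applies. *)
Lemma is_derive_rho_at (al : R -> R) (h x d : R) : 0 < h ->
  locally x (fun y => - (PI / 2) < al y < PI / 2) -> is_derive al x d ->
  d = - / time_density (al x) h ->
  is_derive (fun y => rho_at (al y) h) x
    (2 * tan (al x) * rho_at (al x) h * total (rho_at (al x) h) / (inertia (cos_sq (al x)) * (1 + / be))).
Proof.
  intros hh hloc hd hdd.
  assert (hal : - (PI / 2) < al x < PI / 2) by exact (locally_singleton _ _ hloc).
  pose proof (rho_at_pos _ h hh hal) as hr. pose proof (cos_sq_pos _ hal) as hs.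
  pose proof (rho_at_spec (al x) h hh) as [_ [_ hX]].
  pose proof (inertia_pos _ (cos_sq_bound (al x))) as hm.
  pose proof (conserved _ h hh hal) as hcons.
  pose proof (lead_pos _ hr) as hA.
  assert (hN : 0 < h - Phi (rho_at (al x) h)) by (rewrite hcons; apply Rdiv_lt_0_compat; lra).
  assert (hib : 0 < / be) by now apply Rinv_0_lt_compat.
  set (r := rho_at (al x) h) in *. set (s := cos_sq (al x)) in *.
  assert (hg : is_derive (fun r => lead r / (h - Phi r)) r
    ((dlead r * (h - Phi r) + lead r * ((p - 2) * (1 + be) / be * Rpower (total r) (lead_exp - 1)))
       / (h - Phi r) ^ 2)).
  { evar_last.
    - apply (is_derive_div lead (fun r => h - Phi r)).
      + now apply is_derive_lead.
      + apply (is_derive_minus (fun _ => h) Phi); [apply is_derive_const | apply is_derive_Phi].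
      + lra.
    - unfold minus, plus, opp, zero; cbn -[pow]. field. lra. }
  assert (hgs : is_derive (fun y => lead (rho_at (al y) h) / (h - Phi (rho_at (al y) h))) x
     (- 2 * tan (al x) * s * d)).
  { apply (is_derive_ext_loc (fun y => cos_sq (al y))).
    - generalize hloc. apply filter_imp. intros y hy.
      pose proof (rho_at_pos _ h hh hy) as hry. pose proof (cos_sq_pos _ hy) as hsy.
      pose proof (lead_pos _ hry).
      change (cos_sq (al y) = lead (rho_at (al y) h) / (h - Phi (rho_at (al y) h))).
      rewrite conserved by assumption. field. lra.
    - evar_last.
      + apply (is_derive_comp cos_sq al); [| exact hd].
        destruct (is_derive_cos_sq (al x)) as [h0|h0]; [exact h0 |].
        exfalso. unfold s, cos_sq in hs. rewrite h0 in hs. lra.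
      + unfold scal; simpl; unfold mult; simpl. unfold s. ring. }
  assert (hcr : continuous (fun y => rho_at (al y) h) x).
  { apply (continuous_comp al (fun u => rho_at u h)).
    - eapply is_derive_continuous, hd.
    - now apply continuous_rho_at. }
  assert (hl : (dlead r * (h - Phi r) + lead r * ((p - 2) * (1 + be) / be * Rpower (total r) (lead_exp - 1)))
       / (h - Phi r) ^ 2 = dfirst_int s r * s / lead r).
  { rewrite hcons. unfold dfirst_int, dlead, inertia, kap. field. repeat split; lra. }
  rewrite hl in hg.
  pose proof (dfirst_int_pos s r hX) as hdP.
  evar_last.
  - eapply (inverse_derive (fun r => lead r / (h - Phi r)) (fun y => rho_at (al y) h) x);
      [exact hcr | exact hg | | exact hgs].
    apply Rgt_not_eq, Rdiv_lt_0_compat; nra.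
  - rewrite hdd. unfold time_density. fold s. fold r. unfold dfirst_int, lead.
    pose proof (Rpower_pos (total r) (lead_exp - 1)). pose proof (total_pos r).
    rewrite (Rpower_pred (total r) lead_exp) by assumption.
    field. repeat split; nra.
Qed.

Lemma angle_function_exists (h a b : R) : 0 < h -> Theta h (PI / 2) = b - a ->
  exists al : R -> R, forall x, a < x < b ->
    - (PI / 2) < al x < PI / 2 /\ Theta h (al x) = b - x.
Proof.
  intros hh hL.
  exists (fun x => epsilon (inhabits 0) (fun v => - (PI / 2) < v < PI / 2 /\ Theta h v = b - x)).
  intros x hx.
  apply (epsilon_spec (inhabits 0) (fun v => - (PI / 2) < v < PI / 2 /\ Theta h v = b - x)).
  pose proof PI_RGT_0. pose proof (Theta_start h) as hT0.
  destruct (IVT_gen (Theta h) (- (PI / 2)) (PI / 2) (b - x)) as [v [hv hTv]].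
  - intros z. now apply continuity_pt_filterlim, continuous_Theta.
  - rewrite Rmin_left, Rmax_right by lra. lra.
  - rewrite Rmin_left, Rmax_right in hv by lra. exists v. split; [| exact hTv].
    split.
    + destruct (proj1 hv) as [hv1|hv1]; [exact hv1 |].
      rewrite <- hv1, hT0 in hTv. lra.
    + destruct (proj2 hv) as [hv1|hv1]; [exact hv1 |].
      rewrite hv1 in hTv. lra.
Qed.

Lemma source_solution_exists (a b h : R) : a < b -> 0 < h -> Theta h (PI / 2) = b - a ->
  exists w, source_solution a b w.
Proof.
  intros hab hh hL. destruct (angle_function_exists h a b hh hL) as [al hal].
  pose proof PI_RGT_0 as hpi. pose proof (Theta_start h) as hT0.
  assert (hTinv : forall u v, Theta h u < Theta h v -> u < v).
  { intros u v huv. apply Rnot_le_lt. intros [h0|h0]; [apply (Theta_lt h) in h0; lra | subst; lra]. }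
  assert (hloc : forall x, a < x < b -> locally x (fun y => - (PI / 2) < al y < PI / 2)).
  { intros x hx. generalize (locally_lt_gt x a b hx). apply filter_imp. apply hal. }
  assert (hTd : forall x, a < x < b -> is_derive (fun y => Theta h (al y)) x (- 1)).
  { intros x hx. apply (is_derive_ext_loc (fun y => b - y)).
    - generalize (locally_lt_gt x a b hx). apply filter_imp. intros y hy. symmetry. now apply hal.
    - auto_derive; [exact I | ring]. }
  assert (hald : forall x, a < x < b -> is_derive al x (- / time_density (al x) h)).
  { intros x hx. pose proof (time_density_pos (al x) h hh). evar_last.
    - apply (inverse_derive (Theta h) al x (time_density (al x) h) (- 1)).
      + apply (inverse_continuous (fun _ => True) (Theta h)).
        * intros u v _ _. now apply Theta_lt.
        * now apply filter_forall.
        * now apply filter_forall.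
        * eapply is_derive_continuous, hTd, hx.
      + now apply is_derive_Theta.
      + lra.
      + now apply hTd.
    - field. lra. }
  set (w := fun x => profile (al x) h).
  assert (hwpos : forall x, a < x < b -> 0 < w x).
  { intros x hx. apply profile_pos; [exact hh | now apply hal]. }
  assert (hwd : forall x, a < x < b -> is_derive w x (be * tan (al x) * w x)).
  { intros x hx. destruct (hal x hx) as [halx _].
    pose proof (rho_at_pos _ h hh halx) as hr. pose proof (cos_sq_pos _ halx) as hs.
    pose proof (inertia_pos _ (cos_sq_bound (al x))) as hm.
    pose proof (rho_at_spec (al x) h hh) as [_ [_ hX]].
    unfold w. rewrite profile_eq by assumption.
    apply (is_derive_ext_loc (fun y => Rpower be ((p - 1) * be / p)
      * Rpower (rho_at (al y) h) ((1 + be) / 2) * Rpower (cos_sq (al y)) (- (be / 2)))).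
    { generalize (hloc x hx). apply filter_imp. intros y hy. symmetry. now apply profile_eq. }
    evar_last.
    - apply (is_derive_mult (fun y => Rpower be ((p - 1) * be / p)
        * Rpower (rho_at (al y) h) ((1 + be) / 2)) (fun y => Rpower (cos_sq (al y)) (- (be / 2)))).
      + apply (is_derive_scal (fun y => Rpower (rho_at (al y) h) ((1 + be) / 2))).
        apply (is_derive_Rpower (fun y => rho_at (al y) h)); [exact hr |].
        apply (is_derive_rho_at al h x _ hh (hloc x hx) (hald x hx)). reflexivity.
      + apply (is_derive_Rpower (fun y => cos_sq (al y)) x
          (- 2 * tan (al x) * cos_sq (al x) * (- / time_density (al x) h))); [exact hs |].
        evar_last.
        * apply (is_derive_comp cos_sq al); [| now apply hald].
          destruct (is_derive_cos_sq (al x)) as [h0|h0]; [exact h0 |].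
          exfalso. unfold cos_sq in hs. rewrite h0 in hs. lra.
        * unfold scal; simpl; unfold mult; simpl. ring.
      + intros; apply Rmult_comm.
    - unfold plus, mult; simpl. unfold time_density. field. repeat split; lra. }
  assert (htt : forall x, a < x < b -> slope w x = tan (al x)).
  { intros x hx. pose proof (hwpos x hx). unfold slope.
    rewrite (is_derive_unique _ _ _ (hwd x hx)). field. split; lra. }
  assert (hss : forall x, a < x < b -> / (1 + tan (al x) ^ 2) = cos_sq (al x)).
  { intros x hx. destruct (hal x hx) as [halx _].
    now rewrite <- cos_sq_atan, atan_tan. }
  assert (hvv : forall x, a < x < b -> total (rho_at (al x) h) = kap + excess w x).
  { intros x hx. destruct (hal x hx) as [halx _].
    pose proof (rho_at_pos _ h hh halx) as hr. pose proof (cos_sq_pos _ halx) as hs.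
    unfold total. f_equal. rewrite pospow_Rpower by exact hr.
    unfold excess. rewrite htt by exact hx.
    replace (1 + tan (al x) ^ 2) with (/ cos_sq (al x)).
    2:{ rewrite <- hss by exact hx. apply Rinv_inv. }
    unfold w. rewrite profile_eq by assumption.
    (* Both sides are products of powers of [be], [rho] and [s]; in logarithms the identity is
       linear. *)
    apply ln_inv; [apply Rpower_pos | |].
    { repeat apply Rmult_lt_0_compat; apply Rpower_pos. }
    rewrite !ln_mult by (repeat apply Rmult_lt_0_compat; apply Rpower_pos).
    rewrite !ln_Rpower. rewrite !ln_mult by (repeat apply Rmult_lt_0_compat; apply Rpower_pos).
    rewrite !ln_Rpower, ln_Rinv by exact hs. unfold gamma_exp. field. lra. }
  assert (hflux : forall x, a < x < b -> is_derive (flux p be w) x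
    (- (Rpower (be * w x) (p - 1) * Rpower (1 + slope w x ^ 2) (p / 2) * excess w x
        + lam * weight p be w x * w x))).
  { intros x hx. apply (flux_derive_of_angle w (fun y => tan (al y)) a b); try assumption.
    rewrite hss, <- hvv by exact hx. destruct (hal x hx) as [halx _].
    pose proof (inertia_pos _ (cos_sq_bound (al x))) as hm.
    pose proof (rho_at_spec (al x) h hh) as [_ [_ hX]].
    evar_last.
    - apply (is_derive_comp tan al); [| now apply hald].
      apply is_derive_tan, Rgt_not_eq, cos_gt_0; lra.
    - unfold scal; cbn -[pow]; unfold mult; cbn -[pow]. unfold time_density. field. lra. }
  exists w. split; [split; [exact hwpos | split] | split].
  (* As [x] tends to [a], [Theta h (al x) = b - x] tends to [Theta h (PI/2)], and strict
     monotonicity of [Theta h] forces [al x] to tend to [PI/2]. *)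
  - apply (filterlim_comp _ _ _ al (fun u => profile u h) _ (locally (PI / 2))).
    + apply filterlim_locally. intros eps.
      pose proof (cond_pos eps) as he.
      assert (hlt : Theta h (PI / 2 - eps) < b - a) by (rewrite <- hL; apply Theta_lt; lra).
      set (d := Rmin (b - a) (b - a - Theta h (PI / 2 - eps))).
      assert (hd : 0 < d) by (apply Rmin_pos; lra).
      pose proof (Rmin_l (b - a) (b - a - Theta h (PI / 2 - eps))) as d1. fold d in d1.
      pose proof (Rmin_r (b - a) (b - a - Theta h (PI / 2 - eps))) as d2. fold d in d2.
      apply (locally_intro _ _ d hd). intros x hx hax. apply Rabs_lt_between in hx.
      destruct (hal x ltac:(lra)) as [hx1 hx2].
      assert (PI / 2 - eps < al x) by (apply hTinv; lra).
      apply Rabs_lt_between. unfold minus, plus, opp; simpl. lra.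
    + apply profile_end; [exact hh | apply cos_PI2].
  - apply (filterlim_comp _ _ _ al (fun u => profile u h) _ (locally (- (PI / 2)))).
    + apply filterlim_locally. intros eps.
      pose proof (cond_pos eps) as he.
      assert (hlt : 0 < Theta h (- (PI / 2) + eps)) by (rewrite <- hT0; apply Theta_lt; lra).
      set (d := Rmin (b - a) (Theta h (- (PI / 2) + eps))).
      assert (hd : 0 < d) by (apply Rmin_pos; lra).
      pose proof (Rmin_l (b - a) (Theta h (- (PI / 2) + eps))) as d1. fold d in d1.
      pose proof (Rmin_r (b - a) (Theta h (- (PI / 2) + eps))) as d2. fold d in d2.
      apply (locally_intro _ _ d hd). intros x hx hax. apply Rabs_lt_between in hx.
      destruct (hal x ltac:(lra)) as [hx1 hx2].
      assert (al x < - (PI / 2) + eps) by (apply hTinv; lra).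
      apply Rabs_lt_between. unfold minus, plus, opp; simpl. lra.
    + apply profile_end; [exact hh | rewrite cos_neg; apply cos_PI2].
  - intros x hx. split; [eexists; now apply hwd | eexists; now apply hflux].
  - intros x hx. rewrite (is_derive_unique _ _ _ (hflux x hx)). ring.
Qed.

(** * Comparison with spherical p-harmonic functions *)

Lemma spherical_p_harmonic_angle (a b : R) (phi : R -> R) :
  spherical_p_harmonic p be a b phi ->
  (forall x0 M, a < x0 < b -> exists x, a < x < x0 /\ M < slope phi x) /\
  (forall x0 M, a < x0 < b -> exists x, x0 < x < b /\ slope phi x < M) /\
  (forall x, a < x < b -> is_derive (angle phi) x (1 - kap / inertia (cos_sq (angle phi x)))).
Proof.
  intros [[hpos [hla hlb]] [hreg heq]].
  assert (hd : forall x, a < x < b -> ex_derive phi x) by (intros x hx; now apply hreg).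
  split; [| split].
  - now apply slope_unbounded_left.
  - now apply slope_unbounded_right.
  - intros x hx. replace kap with (kap + 0) by ring.
    apply is_derive_angle, (is_derive_slope phi a b); try assumption.
    rewrite heq by exact hx. ring.
Qed.

(** As [X > m], the clock of level [h] along a trajectory with [al' = 1 - K/m] moves according to
    the sign of [X - K]. *)
Lemma clock_rate (h al K : R) : 0 < h ->
  (1 - K / inertia (cos_sq al)) * time_density al h + 1 = (total (rho_at al h) - K) / (total (rho_at al h) - inertia (cos_sq al)).
Proof.
  intros hh. pose proof (inertia_pos _ (cos_sq_bound al)). pose proof (rho_at_spec al h hh) as [_ [_ hX]].
  unfold time_density. field. lra.
Qed.

Lemma source_solution_exists_of_kap_le_1 (a b : R) : a < b -> kap <= 1 ->
  exists w, source_solution a b w.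
Proof.
  intros hab hK. destruct (length_large (b - a) hK) as [h1 [hh1 hL1]].
  destruct (length_onto (b - a) h1 ltac:(lra) hh1 hL1) as [h [hh hL]].
  now apply (source_solution_exists a b h).
Qed.

Lemma source_equation (q : R) (w : R -> R) (x : R) : q = p / be + p - 1 -> 0 < w x ->
  Rpower (be * w x) (p - 1) * Rpower (1 + slope w x ^ 2) (p / 2) * excess w x
  = Rpower (Rabs (w x)) (q - 1) * w x.
Proof.
  intros hq hw. rewrite Rabs_pos_eq by lra.
  rewrite <- Rpower_pred by exact hw.
  rewrite <- Rpower_mult_distr by assumption. unfold excess.
  rewrite Rpower_Ropp. replace (1 - p) with (- (p - 1)) by ring. rewrite Rpower_Ropp.
  replace q with ((p - 1) + p / be) by lra. rewrite Rpower_plus.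
  pose proof (Rpower_pos be (p - 1)). pose proof (Rpower_pos (1 + slope w x ^ 2) (p / 2)).
  field. split; lra.
Qed.

End Trajectories.

Lemma kap_le (p b1 b2 : R) : 1 < p -> b1 <= b2 -> kap p b1 <= kap p b2.
Proof. intros hp h. unfold kap. nra. Qed.

Lemma kap_lt (p b1 b2 : R) : 1 < p -> b1 < b2 -> kap p b1 < kap p b2.
Proof. intros hp h. unfold kap. nra. Qed.

(** If [bS <= be], then [X > K >= K_S] makes the clock of [w] strictly increasing along [phi]. But
    [w] and [phi] live on the same arc, so its two end bounds coincide and it would be constant. *)
Lemma source_solution_exponent_lt (p be bS a b : R) (w : R -> R) :
  1 < p -> 0 < be -> a < b -> source_solution p be a b w ->
  is_spherical_exponent p a b bS -> be < bS.
Proof.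
  intros hp hbe hab hw [hbS [phi hphi]]. apply Rnot_le_lt. intros hle.
  destruct (source_trajectory p be hp hbe a b w hab hw) as [h [hh ht]].
  destruct (source_solution_length p be hp hbe a b w h hab hh hw
    (fun x hx => proj1 (ht x hx))) as [hL _].
  destruct (spherical_p_harmonic_angle p bS hp hbS a b phi hphi) as [huL [huR hd]].
  set (al := angle bS phi) in *.
  assert (hrate : forall x, 0 < (1 - kap p bS / inertia p (cos_sq (al x))) * time_density p be (al x) h + 1).
  { intros x. rewrite clock_rate by assumption.
    pose proof (rho_at_spec p be hp hbe (al x) h hh) as [_ [_ hX]].
    pose proof (rho_at_pos p be hp hbe (al x) h hh (angle_bound bS phi x)) as hr.
    pose proof (total_lt p be hp hbe 0 _ (Rle_refl 0) hr) as hX0. rewrite total_0 in hX0.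
    pose proof (kap_le p bS be hp hle). apply Rdiv_lt_0_compat; lra. }
  pose proof (clock_ends_rev p be hp hbe a b h (slope bS phi)
    (fun x => 1 - kap p bS / inertia p (cos_sq (al x))) hh huL huR hd
    (fun x _ => Rlt_le _ _ (hrate x))) as hQ.
  set (x := (a + b) / 2). assert (hx : a < x < b) by (unfold x; lra).
  pose proof (is_derive_clock p be hp hbe al h x _ hh (hd x hx)) as hdQ.
  assert (hd0 : is_derive (fun y => Theta p be h (al y) + y) x 0).
  { apply (is_derive_ext_loc (fun _ => b)); [| auto_derive; [exact I | reflexivity]].
    generalize (locally_lt_gt x a b hx). apply filter_imp. intros y hy.
    specialize (hQ y hy). change (atan (slope bS phi y)) with (al y) in hQ. lra. }
  apply is_derive_unique in hdQ. apply is_derive_unique in hd0.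
  specialize (hrate x). lra.
Qed.

(** When [K > 1], the value of [m] at [s = 1] is below [K], and [total_rho_small] with [s0 = 1]
    provides a level with [X <= K_S] at every angle. Its clock is nonincreasing along [phi], so its
    length is at least [b - a]; a higher level, if needed, has exactly this length. When [K <= 1],
    long arcs come from [length_large] instead. *)
Lemma source_solution_exists_of_exponent_lt (p be bS a b : R) :
  1 < p -> 0 < be -> a < b -> is_spherical_exponent p a b bS -> be < bS ->
  exists w, source_solution p be a b w.
Proof.
  intros hp hbe hab [hbS [phi hphi]] hlt.
  destruct (Rle_lt_dec (kap p be) 1) as [hK|hK].
  { now apply source_solution_exists_of_kap_le_1. }
  (* The strict inequality [be < bS] leaves room for a positive [V] with [K + V = K_S]. *)
  destruct (total_onto p be hp hbe (kap p bS)) as [r [hr hXr]]; [now apply kap_lt |].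
  destruct (total_rho_small p be hp hbe 1 r) as [h [hh hX]]; [lra | unfold inertia; lra | exact hr |].
  destruct (spherical_p_harmonic_angle p bS hp hbS a b phi hphi) as [huL [huR hd]].
  assert (hQ := clock_ends p be hp hbe a b h (slope bS phi)
    (fun x => 1 - kap p bS / inertia p (cos_sq (angle bS phi x))) hh huL huR hd).
  assert (hL : b - a <= Theta p be h (PI / 2)).
  { enough (H : forall x, a < x < b ->
      (1 - kap p bS / inertia p (cos_sq (angle bS phi x))) * time_density p be (angle bS phi x) h + 1 <= 0).
    { specialize (hQ H ((a + b) / 2) ltac:(lra)). lra. }
    intros x hx. rewrite clock_rate by assumption.
    set (al := angle bS phi x).
    pose proof (rho_at_spec p be hp hbe al h hh) as [_ [_ hXm]].
    pose proof (hX (cos_sq al) (cos_sq_bound al)) as hXK. fold (rho_at p be al h) in hXK.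
    apply Rle_div_l; lra. }
  destruct (length_onto p be hp hbe (b - a) h ltac:(lra) hh hL) as [h' [hh' hL']].
  now apply (source_solution_exists p be hp hbe a b h').
Qed.

(** * Return to the exponent [q] and conclusion *)

Lemma beta_q_pos (p q : R) : 1 < p -> p - 1 < q -> 0 < beta_q p q.
Proof. intros hp hq. apply Rdiv_lt_0_compat; lra. Qed.

Lemma positive_solution_iff (p q a b : R) (w : R -> R) : 1 < p -> p - 1 < q ->
  positive_solution p q a b w <-> source_solution p (beta_q p q) a b w.
Proof.
  intros hp hq. pose proof (beta_q_pos p q hp hq) as hbe.
  assert (hqb : q = p / beta_q p q + p - 1) by (unfold beta_q; field; lra).
  assert (hlam : lambda_qp p q = lam p (beta_q p q)).
  { unfold lambda_qp, lam. rewrite hqb at 2. field. lra. }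
  split; intros [hpos [hreg heq]]; split; [exact hpos | | exact hpos |];
    (split; [exact hreg |]); intros x hx; specialize (heq x hx); destruct hpos as [hpos _].
  - rewrite (source_equation p (beta_q p q) hbe q) by auto. rewrite <- hlam. lra.
  - rewrite (source_equation p (beta_q p q) hbe q) in heq by auto. rewrite hlam. lra.
Qed.

Theorem corollary1 (p q : R) (hp : 1 < p) (hq : p - 1 < q)
    (a b : R) (hS : is_arc a b) :
  (forall beta_S : R, is_spherical_exponent p a b beta_S ->
     ((exists w : R -> R, positive_solution p q a b w) <-> beta_q p q < beta_S)) /\
  (forall w1 w2 : R -> R,
     positive_solution p q a b w1 -> positive_solution p q a b w2 ->
     forall sigma, a < sigma < b -> w1 sigma = w2 sigma) /\
  (p < 2 -> 2 * (p - 1) / (2 - p) <= q ->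
     exists w : R -> R, positive_solution p q a b w).
Proof.
  pose proof (beta_q_pos p q hp hq) as hbe.
  assert (hab : a < b) by (unfold is_arc in hS; lra).
  split; [| split].
  - intros bS hbS. split.
    + intros [w hw]. apply positive_solution_iff in hw; [| assumption | assumption].
      now apply (source_solution_exponent_lt p _ bS a b w).
    + intros hlt.
      destruct (source_solution_exists_of_exponent_lt p (beta_q p q) bS a b) as [w hw];
        try assumption.
      exists w. now apply positive_solution_iff.
  - intros w1 w2 h1 h2. apply positive_solution_iff in h1, h2; try assumption.
    now apply (source_solution_unique p (beta_q p q)).
  - intros hp2 hq2.
    destruct (source_solution_exists_of_kap_le_1 p (beta_q p q) hp hbe a b hab) as [w hw].
    (* The bound on [q] is [kap <= 1] in disguise: both amount to [(p-1)(q+1) <= q + 1 - p]. *)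
    + apply Rle_div_l in hq2; [| lra]. unfold kap, beta_q.
      replace ((p - 1) * (1 + p / (q + 1 - p))) with ((p - 1) * (q + 1) / (q + 1 - p))
        by (field; lra).
      apply Rle_div_l; [lra |]. nra.
    + exists w. now apply positive_solution_iff.
Qed.
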